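(* Let $r,d\ge 2$ and let $S_{rd}$ be the free solvable group of rank $r$ and derived length (class) $d$. Let $H=\langle g,f\rangle$ be a two-generated subgroup of $S_{rd}$. Then the following are equivalent: (1) $H$ is a retract of $S_{rd}$; (2) $H$ is algebraically closed in $S_{rd}$; (3) $H$ is verbally closed in $S_{rd}$.
   Context: $S_{rd}$ denotes the free group of rank $r$ in the variety of solvable groups of derived length at most $d$. A subgroup $H$ of $G$ is a retract if there is a homomorphism $G\to H$ restricting to the identity on $H$. $H$ is algebraically closed in $G$ if every finite system of equations $E_i(x_1,\dots,x_n,H)=1$ ($i=1,\dots,m$) with constants from $H$ that has a solution in $G$ also has a solution in $H$. Let $F(X)$ be the free group on a countably infinite set $X=\{x_1,x_2,\dots\}$; $H$ is verbally closed in $G$ if for every $w=w(x_1,\dots,x_n)\in F(X)$ and every $h\in H$, the equation $w(x_1,\dots,x_n)=h$ has a solution in $G$ if and only if it has a solution in $H$. *)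

(* Defs.v *)
From Stdlib Require Import List.
Import ListNotations.

Record Group := {
  carrier :> Type;
  gmul : carrier -> carrier -> carrier;
  ginv : carrier -> carrier;
  gone : carrier;
  gmul_assoc : forall a b c, gmul a (gmul b c) = gmul (gmul a b) c;
  gmul_one_l : forall a, gmul gone a = a;
  gmul_one_r : forall a, gmul a gone = a;
  gmul_inv_l : forall a, gmul (ginv a) a = gone;
  gmul_inv_r : forall a, gmul a (ginv a) = gone
}.

Definition is_hom (G K : Group) (phi : G -> K) : Prop :=
  forall a b, phi (gmul G a b) = gmul K (phi a) (phi b).

Inductive gen (G : Group) (S : G -> Prop) : G -> Prop :=
  | gen_in : forall a, S a -> gen G S a
  | gen_one : gen G S (gone G)
  | gen_mul : forall a b, gen G S a -> gen G S b -> gen G S (gmul G a b)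
  | gen_inv : forall a, gen G S a -> gen G S (ginv G a).

Definition commutator (G : Group) (a b : G) : G :=
  gmul G (gmul G (ginv G a) (ginv G b)) (gmul G a b).

Fixpoint derived (G : Group) (k : nat) : G -> Prop :=
  match k with
  | 0 => fun _ => True
  | S k' => gen G (fun c => exists a b, derived G k' a /\ derived G k' b
                                        /\ c = commutator G a b)
  end.

Definition solvable_le (G : Group) (d : nat) : Prop :=
  forall a, derived G d a -> a = gone G.

Definition free_solvable (r d : nat) (G : Group) (x : nat -> G) : Prop :=
  solvable_le G d /\
  (forall a : G, gen G (fun c => exists i, i < r /\ c = x i) a) /\
  (forall (K : Group) (y : nat -> K), solvable_le K d ->
     exists phi : G -> K, is_hom G K phi /\ forall i, i < r -> phi (x i) = y i).

Definition retract (G : Group) (H : G -> Prop) : Prop :=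
  exists phi : G -> G, is_hom G G phi /\ (forall a, H (phi a)) /\
                       (forall h, H h -> phi h = h).

Inductive term (A : Type) : Type :=
  | tvar : nat -> term A
  | tconst : A -> term A
  | tone : term A
  | tmul : term A -> term A -> term A
  | tinv : term A -> term A.
Arguments tvar {A} _.
Arguments tconst {A} _.
Arguments tone {A}.
Arguments tmul {A} _ _.
Arguments tinv {A} _.

Fixpoint eval (G : Group) (asg : nat -> G) (t : term G) : G :=
  match t with
  | tvar n => asg n
  | tconst a => a
  | tone => gone G
  | tmul u v => gmul G (eval G asg u) (eval G asg v)
  | tinv u => ginv G (eval G asg u)
  end.

Fixpoint consts_in {A : Type} (P : A -> Prop) (t : term A) : Prop :=
  match t with
  | tvar _ => True
  | tconst a => P a
  | tone => True
  | tmul u v => consts_in P u /\ consts_in P v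
  | tinv u => consts_in P u
  end.

(** Elements of the free group F(X): words without constants. *)
Inductive word : Type :=
  | wvar : nat -> word
  | wone : word
  | wmul : word -> word -> word
  | winv : word -> word.

Fixpoint weval (G : Group) (asg : nat -> G) (w : word) : G :=
  match w with
  | wvar n => asg n
  | wone => gone G
  | wmul u v => gmul G (weval G asg u) (weval G asg v)
  | winv u => ginv G (weval G asg u)
  end.

Definition alg_closed (G : Group) (H : G -> Prop) : Prop :=
  forall sys : list (term G),
    Forall (consts_in H) sys ->
    (exists asg : nat -> G, Forall (fun E => eval G asg E = gone G) sys) ->
    exists asg : nat -> G, (forall n, H (asg n)) /\
                           Forall (fun E => eval G asg E = gone G) sys.

Definition verbally_closed (G : Group) (H : G -> Prop) : Prop :=
  forall (w : word) (h : G), H h ->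
    ((exists asg : nat -> G, weval G asg w = h) <->
     (exists asg : nat -> G, (forall n, H (asg n)) /\ weval G asg w = h)).

(* Main.v *)
(* Write S for the group and N_k for its k-th derived subgroup. By Magnus, S/N_k embeds in an
   iterated wreath product, so that N_k/N_(k+1) embeds, by Fox derivatives, in a free module
   over Z[S/N_k]; S/N_k is right-orderable, hence this group ring has no zero divisors.

   Let H = <g,f> be verbally closed. If g, f are independent modulo N_1, a single equation
   t(u,v) = t(g,f), with t in N_(d-1), is solved in H and yields an endomorphism of S into H
   fixing t = t_(d-1), where t_(n+1) = [t_n, t_(n-1) t_n t_(n-1)^-1]. Comparing exterior squares
   of N_k/N_(k+1) level by level, some iterate Phi fixes every t_n modulo N_(n+1). Going back
   up, the coprimality of 1 - a and 1 - b for independent commuting a, b shows that Phi is on H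
   the conjugation by some e in the abelian group N_(d-1); then Phi followed by conjugation by
   Phi(e)^-1 is a retraction.

   If g, f are dependent modulo N_1, verbal closedness gives that H meets N_1 in [H,H], and the
   Fox derivative of [g,f] is annihilated at each level by an element of nonzero augmentation.
   So H is abelian, and an endomorphism into H fixing one suitable generator is a retraction. *)

From Stdlib Require Import ZArith Lia List.
From Stdlib Require Import Classical ClassicalEpsilon FunctionalExtensionality PropExtensionality.
From Corelib Require Import ssreflect.
Require Import Defs.
Import ListNotations.
Local Open Scope Z_scope.
Set Implicit Arguments.
Unset Strict Implicit.
Local Arguments Z.mul : simpl never.
Local Arguments Z.add : simpl never.
Local Arguments Z.opp : simpl never.
Local Arguments Z.sub : simpl never.

(* An equation prescribes one value, so a single element has to remember both [g] and [f]. The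
   commutator of two elements of a layer N_k/N_(k+1) remembers only their 2x2 minors, that is, the
   pair up to a rational change of basis of determinant one. Taking for the second element a
   conjugate of the first cuts this down to a sign: if u, Xu and a, wa have the same nonzero minors,
   then u = a or u = -a. The argument leaves this sign open, but it disappears when the endomorphism
   is squared; hence the iterate. In the first layer the ambiguity is an element of the group ring
   instead, and the coefficients of [test2] are so unequal that it can only be 1. On the way up,
   each level determines the map on a pair only up to conjugation by an element of the layer, and
   the conjugator inherited from the preceding level has to be shown trivial one level deeper. This
   works because no nonzero integer multiple of t_(m+1) is divisible by 1 - t_m in its layer. *)
Declare Scope grp_scope.
Notation "a ** b" := (gmul _ a b) (at level 40, left associativity) : grp_scope.
Notation "a ^-1" := (ginv _ a) (at level 3, left associativity, format "a ^-1") : grp_scope.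
Notation "\e" := (gone _) : grp_scope.
Local Open Scope grp_scope.

(** * Elementary group theory: powers, homomorphisms, the derived series *)

Section GroupBasics.
Variable G : Group.
Implicit Types a b c w : G.

Lemma mulA a b c : (a ** b) ** c = a ** (b ** c).
Proof. by rewrite gmul_assoc. Qed.
Lemma mul1g a : \e ** a = a. Proof. exact: gmul_one_l. Qed.
Lemma mulg1 a : a ** \e = a. Proof. exact: gmul_one_r. Qed.
Lemma mulVg a : a^-1 ** a = \e. Proof. exact: gmul_inv_l. Qed.
Lemma mulgV a : a ** a^-1 = \e. Proof. exact: gmul_inv_r. Qed.
Lemma mulKg a b : a^-1 ** (a ** b) = b.
Proof. by rewrite gmul_assoc mulVg mul1g. Qed.
Lemma mulKVg a b : a ** (a^-1 ** b) = b.
Proof. by rewrite gmul_assoc mulgV mul1g. Qed.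
Lemma mulgI a b c : a ** b = a ** c -> b = c.
Proof. by move=> e; rewrite -(mulKg a b) e mulKg. Qed.
Lemma mulIg a b c : b ** a = c ** a -> b = c.
Proof. by move=> e; rewrite -(mulg1 b) -(mulgV a) gmul_assoc e mulA mulgV mulg1. Qed.
Lemma invK a : a^-1^-1 = a.
Proof. by apply: (@mulgI a^-1); rewrite mulgV mulVg. Qed.
Lemma invM a b : (a ** b)^-1 = b^-1 ** a^-1.
Proof. by apply: (@mulgI (a ** b)); rewrite mulgV mulA mulKVg mulgV. Qed.
Lemma inv1 : (gone G)^-1 = \e.
Proof. by rewrite -[LHS]mul1g mulgV. Qed.
Lemma mulV_eq1 a b : a ** b^-1 = \e -> a = b.
Proof. by move=> e; apply: (@mulIg b^-1); rewrite mulgV. Qed.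
Definition gE := (invM, invK, inv1, mulA, mul1g, mulg1, mulVg, mulgV, mulKg, mulKVg).

Definition cj w a := w ** a ** w^-1.
Definition cm a b := a ** b ** a^-1 ** b^-1.

Lemma cm1_comm a b : cm a b = \e -> a ** b = b ** a.
Proof.
move=> e; apply: (@mulIg a^-1); apply: (@mulIg b^-1).
by rewrite -[LHS]/(cm a b) e !gE.
Qed.
Lemma comm_cm1 a b : a ** b = b ** a -> cm a b = \e.
Proof. by move=> e; rewrite /cm e !gE. Qed.

Fixpoint npow a (n : nat) : G := match n with O => \e | S n => a ** npow a n end.
Definition zpow a (z : Z) : G :=
  match z with
  | Z0 => \e | Zpos p => npow a (Pos.to_nat p) | Zneg p => npow a^-1 (Pos.to_nat p)
  end.

Lemma zpow_succ a z : zpow a (Z.succ z) = a ** zpow a z.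
Proof.
case: z => [|p|p]; first by rewrite /= mulg1.
  by rewrite /= Pos2Nat.inj_add Nat.add_comm.
case: (Pos.succ_pred_or p) => [->|<-]; first by rewrite /= mulg1 mulgV.
have -> : Z.succ (Z.neg (Pos.succ (Pos.pred p))) = Z.neg (Pos.pred p) by lia.
by rewrite /= Pos2Nat.inj_succ /= mulKVg.
Qed.
Lemma zpow_pred a z : zpow a (Z.pred z) = a^-1 ** zpow a z.
Proof. by rewrite -{2}(Z.succ_pred z) zpow_succ mulKg. Qed.
Lemma zpow_add a i j : zpow a (i + j) = zpow a i ** zpow a j.
Proof.
elim/Z.peano_ind: i => [|i IH|i IH]; first by rewrite /= mul1g.
  by rewrite Z.add_succ_l !zpow_succ IH mulA.
by rewrite Z.add_pred_l !zpow_pred IH mulA.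
Qed.
Lemma zpow_opp a i : zpow a (- i) = (zpow a i)^-1.
Proof. by apply: (@mulgI (zpow a i)); rewrite -zpow_add Z.add_opp_diag_r mulgV. Qed.
Lemma zpow_1 a : zpow a 1 = a.
Proof. by rewrite -[1%Z]/(Z.succ 0) zpow_succ mulg1. Qed.
Lemma comm_inv a b : a ** b = b ** a -> a^-1 ** b = b ** a^-1.
Proof. by move=> e; apply: (@mulgI a); rewrite mulKVg -mulA e mulA mulgV mulg1. Qed.
Lemma comm_mul a b c : a ** c = c ** a -> b ** c = c ** b -> (a ** b) ** c = c ** (a ** b).
Proof. by move=> e f; rewrite mulA f -mulA e mulA. Qed.
Lemma zpow_comm a b i : a ** b = b ** a -> zpow a i ** b = b ** zpow a i.
Proof.
move=> e; elim/Z.peano_ind: i => [|i IH|i IH]; first by rewrite /= mul1g mulg1.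
  by rewrite zpow_succ; apply: comm_mul.
by rewrite zpow_pred; apply: comm_mul IH; apply: comm_inv.
Qed.
Lemma zpow_mulg a b i : a ** b = b ** a -> zpow (a ** b) i = zpow a i ** zpow b i.
Proof.
move=> e; have cb j : b ** zpow a j = zpow a j ** b by rewrite zpow_comm.
have cb' j : b^-1 ** zpow a j = zpow a j ** b^-1 by apply: comm_inv.
elim/Z.peano_ind: i => [|i IH|i IH]; first by rewrite /= mulg1.
  by rewrite !zpow_succ IH !mulA; congr (_ ** _); rewrite -!mulA cb.
by rewrite !zpow_pred IH e invM !mulA; congr (_ ** _); rewrite -!mulA cb'.
Qed.
Lemma zpow_e i : zpow \e i = \e.
Proof.
elim/Z.peano_ind: i => [|i IH|i IH] //; first by rewrite zpow_succ IH mul1g.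
by rewrite zpow_pred IH inv1 mul1g.
Qed.
Lemma zpow_inv a i : zpow a^-1 i = (zpow a i)^-1.
Proof.
elim/Z.peano_ind: i => [|i IH|i IH]; first by rewrite /= inv1.
  by rewrite !zpow_succ IH -invM zpow_comm.
by rewrite !zpow_pred IH -invM zpow_comm // mulVg mulgV.
Qed.
End GroupBasics.

Section Homs.
Variables (G K : Group) (phi : G -> K).
Hypothesis hphi : is_hom G K phi.
Lemma hom1 : phi \e = \e.
Proof. by apply: (@mulgI _ (phi \e)); rewrite -hphi !gE. Qed.
Lemma homV a : phi a^-1 = (phi a)^-1.
Proof. by apply: (@mulgI _ (phi a)); rewrite -hphi !gE hom1. Qed.
Lemma hom_cm a b : phi (cm a b) = cm (phi a) (phi b).
Proof. by rewrite /cm !hphi !homV. Qed.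
Lemma hom_cj a b : phi (cj a b) = cj (phi a) (phi b).
Proof. by rewrite /cj !hphi !homV. Qed.
Lemma hom_zpow a i : phi (zpow a i) = zpow (phi a) i.
Proof.
elim/Z.peano_ind: i => [|i IH|i IH]; first exact: hom1.
  by rewrite !zpow_succ hphi IH.
by rewrite !zpow_pred hphi homV IH.
Qed.
Lemma hom_weval asg w : phi (weval G asg w) = weval K (fun i => phi (asg i)) w.
Proof. by elim: w => [i||u IH v IH'|u IH] //=; rewrite ?hphi ?homV ?hom1 ?IH ?IH'. Qed.
Lemma hom_der k a : derived G k a -> derived K k (phi a).
Proof.
elim: k a => [|k IH] a //=; elim=> {a} [a [b [c [hb [hc ->]]]]||a b _ ha _ hb|a _ ha].
- apply: gen_in; exists (phi b), (phi c); do !split; try exact: IH.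
  by rewrite /commutator !hphi !homV.
- by rewrite hom1; apply: gen_one.
- by rewrite hphi; apply: gen_mul.
- by rewrite homV; apply: gen_inv.
Qed.
End Homs.

Lemma hom_gen_eq (G K : Group) (p q : G -> K) (P : G -> Prop) :
  is_hom G K p -> is_hom G K q -> (forall a, P a -> p a = q a) ->
  forall a, gen G P a -> p a = q a.
Proof.
move=> hp hq e a; elim=> [b /e|| b c _ eb _ ec|b _ eb] //.
- by rewrite !hom1.
- by rewrite hp hq eb ec.
- by rewrite !homV // eb.
Qed.

Lemma comp_hom (G K L : Group) (p : G -> K) (q : K -> L) :
  is_hom G K p -> is_hom K L q -> is_hom G L (fun a => q (p a)).
Proof. by move=> hp hq a b; rewrite hp hq. Qed.

Lemma cj_hom (G : Group) (w : G) : is_hom G G (cj w).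
Proof. by move=> a b; rewrite /cj !gE. Qed.

Section Derived.
Variable G : Group.
Implicit Types a b c w : G.
Lemma der1 k : derived G k \e.
Proof. by case: k => [|k] //; apply: gen_one. Qed.
Lemma derM k a b : derived G k a -> derived G k b -> derived G k (a ** b).
Proof. by case: k => [|k] //; apply: gen_mul. Qed.
Lemma derV k a : derived G k a -> derived G k a^-1.
Proof. by case: k => [|k] //; apply: gen_inv. Qed.
Lemma der_cm k a b : derived G k a -> derived G k b -> derived G (S k) (cm a b).
Proof.
move=> ha hb; apply: gen_in; exists a^-1, b^-1; do !split; try exact: derV.
by rewrite /commutator /cm !gE.
Qed.
Lemma der_cj k w a : derived G k a -> derived G k (cj w a).
Proof. exact: hom_der (cj_hom w) _ _. Qed.
Lemma der_S k a : derived G (S k) a -> derived G k a.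
Proof.
elim=> {a} [a [b [c [hb [hc ->]]]]||a b _ ha _ hb|a _ ha].
- by apply: derM; apply: derM => //; apply: derV.
- exact: der1.
- exact: derM.
- exact: derV.
Qed.
Lemma der_le k l a : (k <= l)%nat -> derived G l a -> derived G k a.
Proof. by move=> h; elim: h a => [|m _ IH] a // /der_S /IH. Qed.
Lemma solv_le k l : (k <= l)%nat -> solvable_le G k -> solvable_le G l.
Proof. by move=> h s a /(der_le h) /s. Qed.
End Derived.

(* [test_elt g f n] lies in the n-th derived subgroup; solving [test_elt g f (d-1) = const]
   forces rigidity. The coefficients 1, 2, 8 of [test2] are those of [cm g f],
   regarded as a module element, and 8 > 2 (1 + 2). *)
Section TestElements.
Variable G : Group.
Implicit Types g f a b : G.
Definition sq a := a ** a.
Definition test2 g f := cm g f ** (sq (cj g (cm g f)) ** sq (sq (sq (cj f (cm g f))))).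
Fixpoint test_pair g f n : G * G :=
  match n with
  | O => (g, test2 g f)
  | S n => (snd (test_pair g f n),
            cm (snd (test_pair g f n)) (cj (fst (test_pair g f n)) (snd (test_pair g f n))))
  end.
Definition test_elt g f n := fst (test_pair g f n).
Lemma test_eltSS g f n : test_elt g f (S (S n)) =
  cm (test_elt g f (S n)) (cj (test_elt g f n) (test_elt g f (S n))).
Proof. by []. Qed.

Lemma test_elt_closed (P : G -> Prop) g f : (forall a b, P a -> P b -> P (a ** b)) ->
  (forall a, P a -> P a^-1) -> P g -> P f -> forall n, P (test_elt g f n).
Proof.
move=> hM hV hg hf n.
have hcj a b : P a -> P b -> P (cj a b) by move=> ha hb; apply: (hM) (hM _ _ ha hb) (hV _ ha).
have hcm a b : P a -> P b -> P (cm a b).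
  by move=> ha hb; apply: (hM) (hM _ _ (hM _ _ ha hb) (hV _ ha)) (hV _ hb).
have hsq a : P a -> P (sq a) by move=> h; apply: hM.
suff [] : P (fst (test_pair g f n)) /\ P (snd (test_pair g f n)) by [].
by elim: n => [|n [ha hb]] /=; split; rewrite /test2; auto 8.
Qed.
Lemma t2_derived g f : derived G 1 (test2 g f).
Proof.
have h : derived G 1 (cm g f) by apply: der_cm.
have hc w : derived G 1 (cj w (cm g f)) by apply: der_cj.
by rewrite /test2 /sq; do ?[exact: h | exact: hc | apply: derM].
Qed.
Lemma test_elt_derived g f n : derived G n (test_elt g f n).
Proof.
suff [] : derived G n (test_elt g f n) /\ derived G (S n) (test_elt g f (S n)) by [].
elim: n => [|n [ha hb]]; first by split=> //; apply: t2_derived.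
by split=> //; rewrite test_eltSS; apply: der_cm => //; apply: der_cj.
Qed.

Definition expressible (F : (nat -> G) -> G) := exists w, forall asg, weval G asg w = F asg.
Lemma expressible_test_elt F F' n : expressible F -> expressible F' ->
  expressible (fun asg => test_elt (F asg) (F' asg) n).
Proof.
move=> hF hF'.
have hM A B : expressible A -> expressible B -> expressible (fun asg => A asg ** B asg).
  by move=> [u hu] [v hv]; exists (wmul u v) => asg /=; rewrite hu hv.
have hV A : expressible A -> expressible (fun asg => (A asg)^-1).
  by move=> [u hu]; exists (winv u) => asg /=; rewrite hu.
have hcj A B : expressible A -> expressible B -> expressible (fun asg => cj (A asg) (B asg)).
  by move=> hA hB; apply: hM (hM _ _ hA hB) (hV _ hA).
have hcm A B : expressible A -> expressible B -> expressible (fun asg => cm (A asg) (B asg)).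
  by move=> hA hB; apply: hM (hM _ _ (hM _ _ hA hB) (hV _ hA)) (hV _ hB).
have hsq A : expressible A -> expressible (fun asg => sq (A asg)) by move=> hA; apply: hM.
have ht2 : expressible (fun asg => test2 (F asg) (F' asg)).
  have hm := hcm _ _ hF hF'.
  exact: hM hm (hM _ _ (hsq _ (hcj _ _ hF hm)) (hsq _ (hsq _ (hsq _ (hcj _ _ hF' hm))))).
suff [] : expressible (fun asg => test_elt (F asg) (F' asg) n) /\
          expressible (fun asg => test_elt (F asg) (F' asg) (S n)) by [].
elim: n => [|n [ha hb]]; first by split.
by split=> //; apply: (hcm _ _ hb (hcj _ _ ha hb)).
Qed.
End TestElements.

Lemma hom_test_elt (G K : Group) (phi : G -> K) g f n : is_hom G K phi ->
  phi (test_elt g f n) = test_elt (phi g) (phi f) n.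
Proof.
move=> h; have ht : phi (test2 g f) = test2 (phi g) (phi f).
  by rewrite /test2 /sq /cj /cm !(h, homV h).
suff [] : phi (test_elt g f n) = test_elt (phi g) (phi f) n /\
          phi (test_elt g f (S n)) = test_elt (phi g) (phi f) (S n) by [].
by elim: n => [|n [ha hb]]; split=> //; rewrite !test_eltSS (hom_cm h) (hom_cj h) ha hb.
Qed.

(** The Fox derivative with respect to variable 1, which stands for [f]. Its terms stay unevaluated
    words, so that one list serves at every level of the tower. *)
Fixpoint fox (w : word) : list (Z * word) :=
  match w with
  | wvar n => match n with 1%nat => [(1%Z, wone)] | _ => [] end
  | wone => []
  | wmul u v => fox u ++ map (fun e => (fst e, wmul u (snd e))) (fox v)
  | winv u => map (fun e => (- fst e, wmul (winv u) (snd e))) (fox u)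
  end.
Fixpoint expo (w : word) : Z * Z :=
  match w with
  | wvar n => match n with O => (1%Z, 0) | 1%nat => (0, 1%Z) | _ => (0, 0) end
  | wone => (0, 0)
  | wmul u v => (fst (expo u) + fst (expo v), snd (expo u) + snd (expo v))
  | winv u => (- fst (expo u), - snd (expo u))
  end.
Definition wcm u v := wmul (wmul (wmul u v) (winv u)) (winv v).
Definition wcj u v := wmul (wmul u v) (winv u).
Definition wsq u := wmul u u.
Definition wtest2 : word :=
  let m := wcm (wvar 0) (wvar 1) in
  wmul m (wmul (wsq (wcj (wvar 0) m)) (wsq (wsq (wsq (wcj (wvar 1) m))))).
Definition pair_env (G : Group) (g f : G) (n : nat) : G :=
  match n with O => g | 1%nat => f | _ => \e end.
Lemma weval_wtest2 (G : Group) (g f : G) : weval G (pair_env g f) wtest2 = test2 g f.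
Proof. by []. Qed.
(* The Fox derivative of [test2] by [f] has coefficient 2 at [g ** g] modulo the
   commutator subgroup, so it is nonzero. *)
Lemma fox_wtest2 : fold_right
  (fun e s => (if Z.eqb (fst (expo (snd e))) 2 && Z.eqb (snd (expo (snd e))) 0 then fst e else 0) + s)
  0 (fox wtest2) = 2.
Proof. by vm_compute. Qed.

Local Open Scope general_if_scope.
(** * Formal sums *)

Section FiniteSums.
Variable K : Type.
Implicit Types (L : list (Z * K)) (k : K).

Definition eqd k k' : {k = k'} + {k <> k'} := excluded_middle_informative (k = k').
Definition ind k k' : Z := if eqd k k' then 1%Z else 0.
Fixpoint coef L k : Z :=
  match L with nil => 0 | e :: L => fst e * ind (snd e) k + coef L k end.
Definition drop_key k L := filter (fun e => if eqd (snd e) k then false else true) L.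

Lemma ind1 k : ind k k = 1%Z.
Proof. by rewrite /ind; case: eqd. Qed.
Lemma ind0 k k' : k <> k' -> ind k k' = 0.
Proof. by rewrite /ind; case: eqd. Qed.

Lemma coef_drop_key k L k' : k <> k' -> coef (drop_key k L) k' = coef L k'.
Proof.
move=> ne; elim: L => [|[z k''] L IH] //=; case: eqd => [e|_] /=; rewrite IH //.
by rewrite e ind0 //; lia.
Qed.
Lemma coef_drop_key0 k L : coef (drop_key k L) k = 0.
Proof. by elim: L => [|[z k'] L IH] //=; case: eqd => [//|ne] /=; rewrite ind0 // IH; lia. Qed.
Lemma rm_length k L : (length (drop_key k L) <= length L)%nat.
Proof. by elim: L => [|e L IH] //=; case: eqd => _ /=; lia. Qed.
Lemma coef_in L k : coef L k <> 0 -> In k (map snd L).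
Proof.
elim: L => [|[z k'] L IH] //= h; rewrite /ind in h; case: (eqd k' k) h => [->|ne] h; [by left|right].
by apply: IH; lia.
Qed.
Lemma coef_app L L' k : coef (L ++ L') k = coef L k + coef L' k.
Proof. by elim: L => [|e L IH] //=; lia. Qed.

Section Fold.
Variables (V : Type) (R : V -> V -> Prop) (act : Z -> K -> V -> V).
Hypothesis Rrefl : forall v, R v v.
Hypothesis Rsym : forall u v, R u v -> R v u.
Hypothesis Rtrans : forall u v w, R u v -> R v w -> R u w.
Hypothesis actR : forall z k v w, R v w -> R (act z k v) (act z k w).
Hypothesis actC : forall z k z' k' v, R (act z k (act z' k' v)) (act z' k' (act z k v)).
Hypothesis actD : forall z z' k v, R (act z k (act z' k v)) (act (z + z') k v).
Hypothesis act0 : forall k v, R (act 0 k v) v.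
Definition fold_sum L v := fold_right (fun e w => act (fst e) (snd e) w) v L.

Lemma fold_sum_drop_key k L v : R (fold_sum L v) (act (coef L k) k (fold_sum (drop_key k L) v)).
Proof.
elim: L => [|[z k'] L IH] /=; first exact: Rsym.
rewrite /ind; case: (eqd k' k) => [->|ne] /=.
  by apply: Rtrans (actR _ _ IH) _; rewrite Z.mul_1_r.
apply: Rtrans (actR _ _ IH) _; apply: Rtrans (actC _ _ _ _ _) _.
by rewrite Z.mul_0_r.
Qed.

(* The value of a formal sum under an additive interpretation depends only on
   its coefficients. *)
Lemma fold_sum_zero L v : (forall k w, R (act (coef L k) k w) w) -> R (fold_sum L v) v.
Proof.
have [n] : exists n, (length L <= n)%nat by exists (length L).
elim: n L v => [|n IH] [|[z k] L] v //= hn h; try by [lia | apply: Rrefl].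
have := @fold_sum_drop_key k ((z, k) :: L) v; rewrite /=.
move=> /Rtrans; apply; apply: Rtrans (h k _) _.
rewrite /drop_key /=; case: eqd => // _; apply: IH => [|k' w].
  by have := rm_length k L; rewrite /drop_key; lia.
rewrite -/(drop_key k L); case: (eqd k k') => [<-|ne]; first by rewrite coef_drop_key0.
by have := h k' w; rewrite /= ind0 // coef_drop_key // Z.mul_0_r.
Qed.
End Fold.

Definition lin (F : K -> Z) L := fold_right (fun e s => fst e * F (snd e) + s) 0 L.

Lemma lin_zero F L : (forall k, coef L k = 0 \/ F k = 0) -> lin F L = 0.
Proof.
move=> h; apply: (@fold_sum_zero Z eq (fun z k s => z * F k + s)); try (intros; subst; lia).
by move=> k w; case: (h k) => ->; lia.
Qed.
Lemma lin_app F L L' : lin F (L ++ L') = lin F L + lin F L'.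
Proof. by elim: L => [|e L IH] //=; lia. Qed.
Lemma lin_single F L k0 : (forall k, k <> k0 -> coef L k = 0 \/ F k = 0) -> lin F L = coef L k0 * F k0.
Proof.
move=> h; suff : lin F ((- coef L k0, k0) :: L) = 0 by rewrite /=; lia.
apply: lin_zero => k /=; case: (eqd k0 k) => [<-|ne]; first by left; rewrite ind1; lia.
rewrite ind0 // Z.mul_0_r; apply: h; congruence.
Qed.
Definition neg L : list (Z * K) := map (fun e => (- fst e, snd e)) L.
Lemma lin_neg F L : lin F (neg L) = - lin F L.
Proof. by elim: L => [|e L IH] //=; lia. Qed.
Lemma coef_neg L k : coef (neg L) k = - coef L k.
Proof. by elim: L => [|e L IH] //=; lia. Qed.
Lemma lin_ext F L L' : (forall k, coef L k = coef L' k) -> lin F L = lin F L'.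
Proof.
move=> h; suff : lin F (L ++ neg L') = 0 by rewrite lin_app lin_neg; lia.
by apply: lin_zero => k; left; rewrite coef_app coef_neg h; lia.
Qed.
Lemma lin_coef L k : coef L k = lin (fun k' => ind k' k) L.
Proof. by elim: L => [|e L IH] //=; rewrite IH. Qed.
Lemma eq_lin F F' L : (forall k, In k (map snd L) -> F k = F' k) -> lin F L = lin F' L.
Proof. by elim: L => [|e L IH] //= h; rewrite IH ?h; auto. Qed.
Lemma lin_add F F' L : lin (fun k => F k + F' k) L = lin F L + lin F' L.
Proof. by elim: L => [|e L IH] //=; lia. Qed.
Lemma lin_scal z F L : lin (fun k => z * F k) L = z * lin F L.
Proof. by elim: L => [|e L IH] //=; lia. Qed.
Lemma lin_0 L : lin (fun _ => 0) L = 0.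
Proof. by elim: L => [|e L IH] //=; lia. Qed.
Lemma lin_neq0 F L : lin F L <> 0 -> exists2 k, In k (map snd L) & F k <> 0.
Proof.
elim: L => [|e L IH] //= h; case: (classic (F (snd e) = 0)) => [e0|ne]; last by exists (snd e); auto.
by have [|k hk hF] := IH; [lia | exists k; auto].
Qed.
End FiniteSums.

Lemma ind_iff K K' (k l : K) (k' l' : K') : (k = l <-> k' = l') -> ind k l = ind k' l'.
Proof. by rewrite /ind => h; case: eqd => e; case: eqd => // /h. Qed.

Lemma lin_map K K' (h : K -> K') (F : K' -> Z) L :
  lin F (map (fun e => (fst e, h (snd e))) L) = lin (fun k => F (h k)) L.
Proof. by elim: L => [|e L IH] //=; rewrite IH. Qed.

Lemma maximal_exists (X : Type) (lt : X -> X -> Prop) (P : X -> Prop) l :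
  (forall x, ~ lt x x) -> (forall x y z, lt x y -> lt y z -> lt x z) ->
  (exists2 x, In x l & P x) -> exists2 x, In x l & P x /\ forall y, In y l -> P y -> ~ lt x y.
Proof.
move=> irr tr; elim: l => [[x []]|x l IH [x0 hx0 Px0]].
case: (classic (exists2 x, In x l & P x)) => [/IH [y hy [Py my]]|no].
  case: (classic (P x /\ lt y x)) => [[Px yx]|no].
    exists x; [by left|split=> // z [<-|hz] Pz xz]; first exact: (irr x).
    by apply: (my z) => //; apply: tr xz.
  exists y; [by right|split=> // z [<-|hz] Pz xz]; first by apply: no.
  exact: my Pz xz.
have e y : In y l -> ~ P y by move=> hy Py; apply: no; exists y.
case: hx0 => [ex|/e //]; subst x0.
by exists x; [left|split=> // y [<-|/e]].
Qed.

Lemma pigeonhole (X : Type) (Q : nat -> X -> Prop) l :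
  (forall n m x, Q n x -> Q m x -> n = m) -> ~ forall n, exists2 x, In x l & Q n x.
Proof.
move=> hQ h.
have [N hN] : exists N, forall n x, (N <= n)%nat -> In x l -> ~ Q n x.
  elim: l {h} => [|x l [N hN]]; first by exists O.
  case: (classic (exists n0, Q n0 x)) => [[n0 q]|no].
    exists (S (N + n0)) => n y hn [<-|hy] q'; first by have := hQ _ _ _ q q'; lia.
    by apply: hN hy q'; lia.
  by exists N => n y hn [<-|hy] q'; [apply: no; exists n|apply: hN q'].
by have [x hx q] := h N; apply: hN q.
Qed.

(** * Group rings of right-ordered groups *)

Section Functions.
Variables (J : Type) (T : Group).
Implicit Types (u v w : J * T -> Z) (g h : T) (L : list (Z * T)).

(** Left multiplication by [g]. Module elements are functions of arbitrary support, so that equality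
    is extensional and the wreath product is a group without a subset type; finiteness is the
    separate predicate [finsupp]. *)
Definition shift g v : J * T -> Z := fun k => v (fst k, g^-1 ** snd k).
Definition conv L v : J * T -> Z := fun k => lin (fun g => shift g v k) L.
Definition fsub v w : J * T -> Z := fun k => v k - w k.
Definition fadd v w : J * T -> Z := fun k => v k + w k.
Definition fscal z v : J * T -> Z := fun k => z * v k.
Definition zerof : J * T -> Z := fun _ => 0.

Lemma fn_eq v w : (forall k, v k = w k) -> v = w.
Proof. exact: functional_extensionality. Qed.
Lemma eq_fn v w : v = w -> forall k, v k = w k.
Proof. by move=> ->. Qed.
Lemma shift1 v : shift \e v = v.
Proof. by apply: fn_eq => -[j c]; rewrite /shift /= !gE. Qed.
Lemma shiftM g h v : shift (g ** h) v = shift g (shift h v).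
Proof. by apply: fn_eq => -[j c]; rewrite /shift /= !gE. Qed.
Lemma shiftK g v : shift g^-1 (shift g v) = v.
Proof. by rewrite -shiftM !gE shift1. Qed.
Lemma shift_sub g v w : shift g (fsub v w) = fsub (shift g v) (shift g w).
Proof. by []. Qed.
Lemma shift_add g v w : shift g (fadd v w) = fadd (shift g v) (shift g w).
Proof. by []. Qed.
Lemma shift_zerof g : shift g zerof = zerof.
Proof. by []. Qed.
Lemma shift_ind g j c : shift g (ind (j, c)) = ind (j, g ** c).
Proof.
apply: fn_eq => -[j' c']; rewrite /shift /ind /=; case: eqd => e; case: eqd => e' //.
  by case: e'; case: e => -> ->; rewrite !gE.
by case: e; case: e' => <- <-; rewrite !gE.
Qed.
Lemma conv_app L L' v : conv (L ++ L') v = fadd (conv L v) (conv L' v).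
Proof. by apply: fn_eq => k; rewrite /conv lin_app. Qed.
Lemma conv_neg L v : conv (neg L) v = fsub zerof (conv L v).
Proof. by apply: fn_eq => k; rewrite /conv lin_neg /fsub /zerof; lia. Qed.
Lemma conv_sub L v w : conv L (fsub v w) = fsub (conv L v) (conv L w).
Proof.
by apply: fn_eq => k; rewrite /conv /fsub /shift; elim: L => [|e L IH] //=; lia.
Qed.
Lemma conv_zerof L : conv L zerof = zerof.
Proof. by apply: fn_eq => k; rewrite /conv lin_0. Qed.
Lemma conv_nil v : conv nil v = zerof.
Proof. by []. Qed.
Lemma conv_cons z g L v : conv ((z, g) :: L) v = fadd (fscal z (shift g v)) (conv L v).
Proof. by []. Qed.
Lemma conv_one g v : conv [(1%Z, g)] v = shift g v.
Proof. by apply: fn_eq => k; rewrite /conv /=; lia. Qed.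
Definition lmul g L : list (Z * T) := map (fun e => (fst e, g ** snd e)) L.
Lemma conv_lmul g L v : conv (lmul g L) v = shift g (conv L v).
Proof. by apply: fn_eq => k; rewrite /conv lin_map /=; apply: eq_lin => h _; rewrite shiftM. Qed.
Lemma lin_lmul g L : lin (fun _ => 1%Z) (lmul g L) = lin (fun _ => 1%Z) L.
Proof. exact: (lin_map (fun h => g ** h) (fun _ => 1%Z)). Qed.
Lemma conv_shift g L v : (forall h, In h (map snd L) -> h ** g = g ** h) ->
  conv L (shift g v) = shift g (conv L v).
Proof.
by move=> c; apply: fn_eq => k; rewrite /conv; apply: eq_lin => h /c e; rewrite -shiftM e shiftM.
Qed.
Lemma conv_ext L L' v : (forall g, coef L g = coef L' g) -> conv L v = conv L' v.
Proof. by move=> e; apply: fn_eq => k; apply: lin_ext. Qed.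
Definition pmul L L' : list (Z * T) :=
  flat_map (fun e => map (fun e' => (fst e * fst e', snd e ** snd e')) L') L.
Lemma conv_pmul L L' v : conv (pmul L L') v = conv L (conv L' v).
Proof.
apply: fn_eq => k; elim: L => [|[z g] L IH] //; rewrite conv_cons /= conv_app /fadd IH; congr (_ + _).
rewrite -(conv_lmul g L' v) /conv /fscal /=; elim: L' {IH} => [|e L' IH] //=; first by lia.
by rewrite IH; lia.
Qed.
End Functions.

Section Ordered.
Variables (T : Group) (im : T -> Prop) (lt : T -> T -> Prop).

(** The order is total only on [im], later the image of the free solvable group: a function of
    infinite support may have no leading coefficient to compare. *)
Record right_order : Prop := RightOrder {
  im1 : im \e;
  imM : forall a b, im a -> im b -> im (a ** b);
  imV : forall a, im a -> im a^-1;
  lt_irr : forall a, ~ lt a a;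
  lt_trans : forall a b c, lt a b -> lt b c -> lt a c;
  lt_mulr : forall a b c, lt a b -> lt (a ** c) (b ** c);
  lt_total : forall a b, im a -> im b -> a = b \/ lt a b \/ lt b a }.

Section FiniteSupport.
Variables (J : Type) (ok : J -> Prop).
Definition good (e : Z * (J * T)) := ok (fst (snd e)) /\ im (snd (snd e)).
Definition finsupp (v : J * T -> Z) := exists2 L, Forall good L & v = coef L.
End FiniteSupport.

Hypothesis hT : right_order.

Lemma im_zpow a i : im a -> im (zpow a i).
Proof.
move=> h; elim/Z.peano_ind: i => [|i IH|i IH]; first exact: im1.
  by rewrite zpow_succ; apply: imM.
by rewrite zpow_pred; apply: imM IH => //; apply: imV.
Qed.

Section WithIndex.
Variables (J : Type) (ok : J -> Prop).
Implicit Types (u v w : J * T -> Z) (L : list (Z * T)).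
Notation finsupp := (finsupp ok).

Lemma finsupp_zerof : finsupp (@zerof J T).
Proof. by exists nil. Qed.
Lemma finsupp_add v w : finsupp v -> finsupp w -> finsupp (fadd v w).
Proof.
move=> [L h ->] [L' h' ->]; exists (L ++ L'); first by apply/Forall_app.
by apply: fn_eq => k; rewrite coef_app.
Qed.
Lemma finsupp_scal z v : finsupp v -> finsupp (fscal z v).
Proof.
move=> [L h ->]; exists (map (fun e => (z * fst e, snd e)) L).
  by apply/Forall_map; apply: Forall_impl h => -[].
by apply: fn_eq => k; rewrite /fscal; elim: L {h} => [|e L IH] /=; lia.
Qed.
Lemma finsupp_sub v w : finsupp v -> finsupp w -> finsupp (fsub v w).
Proof.
move=> hv hw; have -> : fsub v w = fadd v (fscal (-1) w).
  by apply: fn_eq => k; rewrite /fsub /fadd /fscal; lia.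
by apply: finsupp_add => //; apply: finsupp_scal.
Qed.
Lemma finsupp_shift g v : im g -> finsupp v -> finsupp (shift g v).
Proof.
move=> hg [L h ->]; exists (map (fun e => (fst e, (fst (snd e), g ** snd (snd e)))) L).
  by apply/Forall_map; apply: Forall_impl h => -[z [j c]] [] /= ? ?; split=> //=; apply: imM.
apply: fn_eq => k; elim: L {h} => [|[z [j c]] L IH] //=; rewrite -IH /shift /=; congr (_ * _ + _).
by rewrite -shift_ind.
Qed.
Lemma finsupp_ind j c : ok j -> im c -> finsupp (ind (j, c)).
Proof.
move=> hj hc; exists [(1%Z, (j, c))]; first by constructor.
by apply: fn_eq => k /=; lia.
Qed.
Lemma finsupp_conv L v : Forall (fun e => im (snd e)) L -> finsupp v -> finsupp (conv L v).
Proof.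
move=> hL hv; elim: L hL => [|[z g] L IH] hL; first exact: finsupp_zerof.
by rewrite conv_cons; inversion_clear hL; apply: finsupp_add (IH _) => //; apply/finsupp_scal/finsupp_shift.
Qed.
Lemma finsupp_supp v j c : finsupp v -> v (j, c) <> 0 -> ok j /\ im c.
Proof.
move=> [L h ->] ne; have hin := coef_in ne; have [[z k] [/= -> hin']] := proj1 (in_map_iff _ _ _) hin.
exact: (proj1 (Forall_forall _ _) h _ hin').
Qed.

(* The coefficient of the largest product [g ** c] does not cancel. *)
Lemma no_zero_divisors L v : Forall (fun e => im (snd e)) L -> finsupp v ->
  conv L v = @zerof J T -> v <> @zerof J T -> forall g, coef L g = 0.
Proof.
move=> hL hv e0 v0 g1; apply: NNPP => hg1.
have [[j c1] hc1] : exists k, v k <> 0.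
  by apply: not_all_ex_not => h; apply: v0; apply: fn_eq.
have [M hM eM] := hv.
pose P p := fst (snd p) = j /\ coef L (fst p) <> 0 /\ v (snd p) <> 0.
pose ltp (p q : T * (J * T)) := lt (fst p ** snd (snd p)) (fst q ** snd (snd q)).
have irr p : ~ ltp p p by exact: (lt_irr hT).
have tr p q s : ltp p q -> ltp q s -> ltp p s by exact: (lt_trans hT).
have [|[g0 [j' c0]] _ [[/= ej [hg0 hc0]] mx]] :=
  @maximal_exists _ ltp P (list_prod (map snd L) (map snd M)) irr tr.
  by exists (g1, (j, c1)) => //; apply: in_prod; apply: coef_in; rewrite -?eM.
subst j'.
have {}mx g c : coef L g <> 0 -> v (j, c) <> 0 -> ~ lt (g0 ** c0) (g ** c).
  move=> h h'; apply: (mx (g, (j, c))) => //.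
  by apply: in_prod; apply: coef_in; rewrite -?eM.
have img g : coef L g <> 0 -> im g.
  move=> ne; have hin := coef_in ne; have [[z k] [/= -> hin']] := proj1 (in_map_iff _ _ _) hin.
  exact: (proj1 (Forall_forall _ _) hL _ hin').
have := eq_fn e0 (j, g0 ** c0); rewrite /conv (lin_single (k0 := g0)); last first.
  by rewrite /shift /= mulKg /zerof; nia.
move=> g ne; case: (classic (coef L g = 0)) => [|hg]; [by left|right].
apply: NNPP; rewrite /shift /= => hc; set c := _ ** _ in hc.
have ec : g0 ** c0 = g ** c by rewrite /c mulKVg.
(* If [g] differs from [g0], one of [g0 ** c] and [g ** c0] exceeds the maximal product; right
   invariance suffices for this. *)
case: (lt_total hT (img _ hg) (img _ hg0)) => [//|[l|l]].
  by apply: (mx g0 c) => //; rewrite ec; apply: lt_mulr.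
by apply: (mx g c0) => //; apply: lt_mulr.
Qed.

Lemma shift_fixed g v : im g -> g <> \e -> finsupp v -> v = shift g v -> v = @zerof J T.
Proof.
move=> hg ne hv e; apply: NNPP => v0.
have := @no_zero_divisors [(1%Z, \e); (-1, g)] v _ hv _ v0 g; rewrite /= ind1 ind0; first by congruence.
move=> h; have : 1 * 0 + (-1 * 1 + 0) = 0; last by [].
apply: h; first by do !constructor => //; apply: im1.
apply: fn_eq => k; rewrite /conv /= shift1 -e /zerof; lia.
Qed.

Lemma shift_fixed_sub g v w : im g -> g <> \e -> finsupp v -> finsupp w ->
  fsub v (shift g v) = fsub w (shift g w) -> v = w.
Proof.
move=> hg ne hv hw e; have : fsub v w = @zerof J T.
  apply: (shift_fixed hg ne) => //; first exact: finsupp_sub.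
  rewrite shift_sub; apply: fn_eq => k; have := eq_fn e k; rewrite /fsub; lia.
by move=> h; apply: fn_eq => k; have := eq_fn h k; rewrite /fsub /zerof; lia.
Qed.

Variables a b : T.
Hypotheses (ia : im a) (ib : im b) (ab : a ** b = b ** a).
Hypothesis indep : forall i j, zpow a i ** zpow b j = \e -> i = 0 /\ j = 0.

Let a_neq1 : a <> \e.
Proof. by move=> e; have [//] : 1%Z = 0 /\ 0 = 0; apply: indep; rewrite zpow_1 e !gE. Qed.

(** A representative of the orbit of [c] under powers of [a]: [epsilon] receives equal predicates
    along an orbit, so its choice depends only on the orbit. *)
Definition orep c : T := epsilon (inhabits \e) (fun c' => exists i, c' = zpow a i ** c).
Let orepE c : exists i, orep c = zpow a i ** c.
Proof.
apply: (epsilon_spec (inhabits \e) (fun c' => exists i, c' = zpow a i ** c)).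
by exists c, 0; rewrite mul1g.
Qed.
Let orep_act i c : orep (zpow a i ** c) = orep c.
Proof.
rewrite /orep; congr (epsilon _ _); apply: functional_extensionality => c'.
apply: propositional_extensionality; split=> -[l ->].
  by exists (l + i); rewrite zpow_add mulA.
by exists (l - i); rewrite gmul_assoc -zpow_add; congr (zpow _ _ ** _); lia.
Qed.
Let orep_eq c c' : orep c = orep c' -> exists i, c' = zpow a i ** c.
Proof.
have [i ->] := orepE c; have [i' ->] := orepE c' => e; exists (- i' + i).
by rewrite zpow_add mulA e gmul_assoc -zpow_add Z.add_opp_diag_l mul1g.
Qed.

Let orbsum (M : list (Z * (J * T))) j c : Z := lin (fun k => ind (fst k, orep (snd k)) (j, orep c)) M.

Let moves (v : J * T -> Z) := exists2 w, finsupp w & v = fsub w (shift a w).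

Let moves_add v w : moves v -> moves w -> moves (fadd v w).
Proof.
move=> [v' hv ->] [w' hw ->]; exists (fadd v' w'); first exact: finsupp_add.
by apply: fn_eq => k; rewrite /fadd /fsub /shift; lia.
Qed.
Let moves_scal z v : moves v -> moves (fscal z v).
Proof.
move=> [v' hv ->]; exists (fscal z v'); first exact: finsupp_scal.
by apply: fn_eq => k; rewrite /fscal /fsub /shift; lia.
Qed.
Let moves_pow i v : finsupp v -> moves (fsub v (shift (zpow a i) v)).
Proof.
move=> hv; elim/Z.peano_ind: i => [|i IH|i IH].
- exists (@zerof J T); first exact: finsupp_zerof.
  by rewrite shift1; apply: fn_eq => k; rewrite /fsub /shift /zerof; lia.
- have h : moves (fsub (shift (zpow a i) v) (shift a (shift (zpow a i) v))).
    by exists (shift (zpow a i) v) => //; apply: finsupp_shift => //; apply: im_zpow.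
  move: (moves_add IH h); rewrite zpow_succ shiftM.
  by congr moves; apply: fn_eq => k; rewrite /fadd /fsub; lia.
- have h : moves (fsub (shift (zpow a (Z.pred i)) v) (shift a (shift (zpow a (Z.pred i)) v))).
    by exists (shift (zpow a (Z.pred i)) v) => //; apply: finsupp_shift => //; apply: im_zpow.
  move: (moves_add IH (moves_scal (-1) h)); rewrite -shiftM -zpow_succ Z.succ_pred.
  by congr moves; apply: fn_eq => k; rewrite /fadd /fsub /fscal; lia.
Qed.

(** Modulo the image of [1 - a] every point can be moved to its orbit representative, so an element
    whose orbit sums vanish lies in that image. *)
Let moves_orep M : Forall (good ok) M ->
  moves (fsub (coef M) (coef (map (fun e => (fst e, (fst (snd e), orep (snd (snd e))))) M))).
Proof.
elim: M => [_|[z [j c]] M IH hM].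
  by exists (@zerof J T); [apply: finsupp_zerof | apply: fn_eq].
have [[/= hj hc] hM'] : good ok (z, (j, c)) /\ Forall (good ok) M by inversion hM.
have [i e] := orepE c.
have := moves_add (moves_scal z (moves_pow i (finsupp_ind hj hc))) (IH hM').
congr moves; rewrite shift_ind -e.
by apply: fn_eq => k; rewrite /fadd /fscal /fsub /=; lia.
Qed.

(* Pushing the relation forward to functions on the <a>-orbits kills the right
   hand side; there b acts with infinite orbits, so p sums to 0 on each <a>-orbit. *)
Lemma coprime_division p q : finsupp p -> finsupp q ->
  fsub p (shift b p) = fsub q (shift a q) ->
  exists2 v, finsupp v & p = fsub v (shift a v) /\ q = fsub v (shift b v).
Proof.
move=> hp hq e; have [Lp gp ep] := hp; have [Lq gq eqq] := hq.
have smL (g : T) (M : list (Z * (J * T))) : exists2 M', shift g (coef M) = coef M' &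
    forall F, lin F M' = lin (fun k => F (fst k, g ** snd k)) M.
  exists (map (fun e => (fst e, (fst (snd e), g ** snd (snd e)))) M); last first.
    by move=> F; rewrite (lin_map (fun k => (fst k, g ** snd k))).
  apply: fn_eq => k; elim: M => [|[z [j c]] M IH] //=; rewrite -IH /shift /=; congr (_ * _ + _).
  by rewrite -shift_ind.
have [Mp eMp lMp] := smL b Lp; have [Mq eMq lMq] := smL a Lq.
have orep_b c c' g : g ** a = a ** g -> orep c = orep c' -> orep (g ** c) = orep (g ** c').
  by move=> cg /orep_eq [i ->]; rewrite -(mulA g) -zpow_comm // mulA orep_act.
have cb : b^-1 ** a = a ** b^-1 by apply: comm_inv.
have inv j c : orbsum Lp j c = orbsum Lp j (b^-1 ** c).
  have : orbsum Mp j c = orbsum Lp j (b^-1 ** c).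
    rewrite /orbsum lMp; apply: eq_lin => -[j' c'] _ /=; apply: ind_iff; split=> -[->].
      by move=> /(orep_b _ _ b^-1 cb) <-; rewrite mulKg.
    by move=> /(orep_b _ _ b (eq_sym ab)) ->; rewrite mulKVg.
  have : orbsum Mq j c = orbsum Lq j c.
    by rewrite /orbsum lMq; apply: eq_lin => -[j' c'] _ /=; rewrite -{1}(zpow_1 a) orep_act.
  have : orbsum (Lp ++ neg Mp) j c = orbsum (Lq ++ neg Mq) j c.
    apply: lin_ext => k; rewrite !coef_app !coef_neg -eMp -eMq -ep -eqq.
    by have := eq_fn e k; rewrite /fsub; lia.
  rewrite /orbsum !lin_app !lin_neg; lia.
have sum0 j c : orbsum Lp j c = 0.
  apply: NNPP => ne.
  have invn n : orbsum Lp j c = orbsum Lp j (zpow b (- Z.of_nat n) ** c).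
    elim: n => [|n ->]; first by rewrite mul1g.
    by rewrite inv Nat2Z.inj_succ Z.opp_succ zpow_pred mulA.
  pose Q n (k : J * T) := orep (snd k) = orep (zpow b (- Z.of_nat n) ** c).
  apply: (@pigeonhole _ Q (map snd Lp)) => [n m k|n].
    rewrite /Q => -> /orep_eq [i /(f_equal (fun t => t ** c^-1))]; rewrite !gE => ei.
    suff [_] : i = 0 /\ Z.of_nat m - Z.of_nat n = 0 by lia.
    apply: indep; have -> : Z.of_nat m - Z.of_nat n = - Z.of_nat n + Z.of_nat m by lia.
    by rewrite zpow_add gmul_assoc -ei -zpow_add Z.add_opp_diag_l.
  have [k hk hne] : exists2 k, In k (map snd Lp) &
      ind (fst k, orep (snd k)) (j, orep (zpow b (- Z.of_nat n) ** c)) <> 0.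
    by apply: lin_neq0; rewrite -/(orbsum Lp j (zpow b (- Z.of_nat n) ** c)) -invn.
  by exists k => //; move: hne; rewrite /ind; case: eqd => // -[].
have e0 : coef (map (fun e => (fst e, (fst (snd e), orep (snd (snd e))))) Lp) = @zerof J T.
  apply: fn_eq => -[j c]; rewrite lin_coef (lin_map (fun k => (fst k, orep (snd k)))).
  case: (classic (orep c = c)) => [ec|ne]; first by rewrite -[RHS](sum0 j c) /orbsum ec.
  rewrite /zerof -[RHS](@lin_0 _ Lp); apply: eq_lin => -[j' c'] _ /=; apply: ind0 => -[_ ec].
  by case: ne; rewrite -ec; have [i {1}->] := orepE c'; rewrite orep_act.
have [v hv] := moves_orep gp; rewrite -ep e0 => ev'.
have epv : p = fsub v (shift a v).
  by rewrite -ev'; apply: fn_eq => k; rewrite /fsub /zerof; lia.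
(* Multiplication by [1 - a] is injective and can be cancelled in [(1 - b)(1 - a) v = (1 - a) q]. *)
exists v => //; split=> //; apply: (shift_fixed_sub ia a_neq1) => //.
  by apply: finsupp_sub => //; apply: finsupp_shift.
by rewrite -e epv !shift_sub -!shiftM ab; apply: fn_eq => k; rewrite /fsub; lia.
Qed.
End WithIndex.
End Ordered.
Section TorsionFree.
Variables (T : Group) (im : T -> Prop) (lt : T -> T -> Prop).
Hypothesis hT : right_order im lt.
Lemma torsion_free a i : im a -> i <> 0 -> zpow a i = \e -> a = \e.
Proof.
move=> ha hi; have key n : npow a (S n) = \e -> a = \e.
  move=> e; case: (lt_total hT ha (im1 hT)) => [//|h]; exfalso.
  case: h => h; have h' m := lt_mulr hT (npow a m) h; apply: (lt_irr hT (a := \e)).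
    have : lt (npow a (S n)) \e; last by rewrite e.
    elim: n {e} => [|n IH]; first by rewrite /= mulg1.
    by apply: (lt_trans hT) IH; have := h' (S n); rewrite mul1g.
  have : lt \e (npow a (S n)); last by rewrite e.
  elim: n {e} => [|n IH]; first by rewrite /= mulg1.
  by apply: (lt_trans hT) IH _; have := h' (S n); rewrite mul1g.
have key' j : 0 < j -> zpow a j = \e -> a = \e.
  by case: j => // p _ /=; case: (Pos2Nat.is_succ p) => n ->; apply: key.
case: (Z_lt_le_dec 0 i) => hi'; first exact: key'.
move=> e; apply: (key' (- i)); first lia.
by rewrite zpow_opp e inv1.
Qed.
End TorsionFree.

(** * The Magnus tower *)

Section Wreath.
Variables (J : Type) (T : Group).
Implicit Types a b c : (J * T -> Z) * T.
Definition wreath_mul a b : (J * T -> Z) * T := (fadd (fst a) (shift (snd a) (fst b)), snd a ** snd b).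
Definition wreath_inv a : (J * T -> Z) * T := (fsub (@zerof J T) (shift (snd a)^-1 (fst a)), (snd a)^-1).
Definition wreath_one : (J * T -> Z) * T := (@zerof J T, \e).

Lemma wreath_assoc a b c : wreath_mul a (wreath_mul b c) = wreath_mul (wreath_mul a b) c.
Proof.
rewrite /wreath_mul /= shift_add -shiftM gmul_assoc; congr (_, _).
by apply: fn_eq => k; rewrite /fadd; lia.
Qed.
Lemma wreath_one_l a : wreath_mul wreath_one a = a.
Proof. by case: a => f a; rewrite /wreath_mul /= shift1 mul1g; congr (_, _); apply: fn_eq. Qed.
Lemma wreath_one_r a : wreath_mul a wreath_one = a.
Proof.
case: a => f a; rewrite /wreath_mul /= mulg1; congr (_, _).
by apply: fn_eq => k; rewrite /fadd /shift /zerof; lia.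
Qed.
Lemma wreath_inv_l a : wreath_mul (wreath_inv a) a = wreath_one.
Proof. by rewrite /wreath_mul /= mulVg; congr (_, _); apply: fn_eq => k; rewrite /fadd /fsub /zerof; lia. Qed.
Lemma wreath_inv_r a : wreath_mul a (wreath_inv a) = wreath_one.
Proof.
rewrite /wreath_mul /= mulgV shift_sub -shiftM mulgV shift1; congr (_, _).
by apply: fn_eq => k; rewrite /fadd /fsub /shift /zerof; lia.
Qed.
Definition wreath : Group := Build_Group _ _ _ _ wreath_assoc wreath_one_l wreath_one_r wreath_inv_l wreath_inv_r.

Lemma snd_hom : is_hom wreath T snd.
Proof. by []. Qed.

(** The source of the divisibility arguments below: an equation between commutators becomes one
    between multiples of [1 - b] and of [1 - a]. *)
Lemma wreath_cm (a b : wreath) : snd a ** snd b = snd b ** snd a ->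
  fst (cm a b) = fsub (fsub (fst a) (shift (snd b) (fst a))) (fsub (fst b) (shift (snd a) (fst b))).
Proof.
move=> e; rewrite /cm /= e !shift_sub -!shiftM !gE !shift1 !shift_zerof.
by apply: fn_eq => p; rewrite /fadd /fsub /zerof; lia.
Qed.

Lemma solvable_wreath k : solvable_le T k -> solvable_le wreath (S k).
Proof.
move=> sT a; have kd b : derived wreath k b -> snd b = \e by move=> /(hom_der snd_hom) /sT.
have ke b : derived wreath k b -> exists f, b = (f, \e) by case: b => f b /kd /= ->; exists f.
elim=> {a} [a [b [c [/ke [f ->] [/ke [f' ->] ->]]]]||a b _ -> _ ->|a _ ->].
- rewrite /commutator /= /wreath_mul /wreath_inv /= !gE !shift1; congr (_, _).
  by apply: fn_eq => k'; rewrite /fadd /fsub /zerof; lia.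
- by [].
- by rewrite mul1g.
- by rewrite inv1.
Qed.
End Wreath.

Definition trivial_group : Group :=
  Build_Group unit (fun _ _ => tt) (fun _ => tt) tt (fun _ _ _ => eq_refl)
    (fun a => match a with tt => eq_refl end) (fun a => match a with tt => eq_refl end)
    (fun _ => eq_refl) (fun _ => eq_refl).

(** All of [nat] indexes the coordinates, which keeps the tower independent of the rank; the indices
    are bounded by the rank in [finsupp]. *)
Fixpoint tower k : Group := match k with O => trivial_group | S k => wreath nat (tower k) end.
Fixpoint tower_gen k i : tower k :=
  match k return tower k with O => tt | S k => (ind (i, \e), tower_gen k i) end.

Lemma tower_solvable k : solvable_le (tower k) k.
Proof. by elim: k => [[]|k IH] //; apply: solvable_wreath. Qed.

Section FreeSolvable.
Variables (r d : nat) (G : Group) (x : nat -> G).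
Hypothesis hfree : free_solvable r d G x.
Implicit Types s t : G.

Lemma gen_ind_x (P : G -> Prop) : (forall i, (i < r)%nat -> P (x i)) -> P \e ->
  (forall s t, P s -> P t -> P (s ** t)) -> (forall s, P s -> P s^-1) -> forall s, P s.
Proof.
move=> hx h1 hM hV s; have [_ [/(_ s) hs _]] := hfree.
by elim: hs => [_ [i [hi ->]]||a b _ ha _ hb|a _ ha]; auto.
Qed.
Lemma lift (K : Group) (y : nat -> K) k : solvable_le K k -> (k <= d)%nat ->
  exists phi : G -> K, is_hom G K phi /\ forall i, (i < r)%nat -> phi (x i) = y i.
Proof. by move=> sK hk; have [_ [_ h]] := hfree; apply: h; apply: solv_le sK. Qed.
Lemma hom_x_eq (K : Group) (p q : G -> K) : is_hom G K p -> is_hom G K q ->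
  (forall i, (i < r)%nat -> p (x i) = q (x i)) -> forall s, p s = q s.
Proof.
move=> hp hq h; apply: gen_ind_x => [//||s t es et|s es].
- by rewrite !hom1.
- by rewrite hp hq es et.
- by rewrite !homV // es.
Qed.

(* The Magnus homomorphism; its kernel is the k-th derived subgroup ([ker_rho]). *)
Definition rho k : G -> tower k :=
  epsilon (inhabits (fun _ => \e))
    (fun p => is_hom G (tower k) p /\ forall i, (i < r)%nat -> p (x i) = tower_gen k i).
Lemma rho_spec k : (k <= d)%nat ->
  is_hom G (tower k) (rho k) /\ forall i, (i < r)%nat -> rho k (x i) = tower_gen k i.
Proof. move=> hk; apply: (epsilon_spec (inhabits (fun _ => \e))
    (fun p => is_hom G (tower k) p /\ forall i, (i < r)%nat -> p (x i) = tower_gen k i)).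
by apply: lift hk; apply: tower_solvable. Qed.
Lemma rho_hom k : (k <= d)%nat -> is_hom G (tower k) (rho k).
Proof. by move=> /rho_spec []. Qed.
Lemma rho_x k i : (k <= d)%nat -> (i < r)%nat -> rho k (x i) = tower_gen k i.
Proof. by move=> /rho_spec [] _; apply. Qed.

(* [D k s] is the vector of Fox derivatives of [s] with coefficients in level k. *)
Definition D k s : nat * tower k -> Z := fst (rho (S k) s).
Arguments D : clear implicits.
Lemma rho_snd k s : (S k <= d)%nat -> snd (rho (S k) s) = rho k s.
Proof.
move=> hk; have hk' : (k <= d)%nat by lia.
apply: (hom_x_eq (p := fun s => snd (rho (S k) s))) => [||i hi].
- exact: comp_hom (rho_hom hk) (@snd_hom _ _).
- exact: rho_hom.
- by rewrite !rho_x.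
Qed.
Lemma rhoE k s : (S k <= d)%nat -> rho (S k) s = (D k s, rho k s).
Proof. by move=> hk; rewrite -(@rho_snd k) // /D; case: (rho (S k) s). Qed.
Lemma rho_inj k s t : (S k <= d)%nat -> D k s = D k t -> rho k s = rho k t -> rho (S k) s = rho (S k) t.
Proof. by move=> hk e e'; rewrite !rhoE // e e'. Qed.
Lemma rho_proj k s t : (S k <= d)%nat -> rho (S k) s = rho (S k) t -> D k s = D k t /\ rho k s = rho k t.
Proof. by move=> hk; rewrite !rhoE // => -[]. Qed.
Lemma rho_le k l s t : (k <= l)%nat -> (l <= d)%nat -> rho l s = rho l t -> rho k s = rho k t.
Proof.
elim=> [//|m _ IH] hm /rho_proj [] // _; apply: IH; lia.
Qed.
Lemma rho1 k : (k <= d)%nat -> rho k \e = \e.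
Proof. by move=> hk; apply: hom1; apply: rho_hom. Qed.
Lemma rhoM k s t : (k <= d)%nat -> rho k (s ** t) = rho k s ** rho k t.
Proof. by move=> hk; apply: rho_hom. Qed.
Lemma rhoV k s : (k <= d)%nat -> rho k s^-1 = (rho k s)^-1.
Proof. by move=> hk; apply: homV; apply: rho_hom. Qed.
Lemma rho_le1 k l s : (k <= l)%nat -> (l <= d)%nat -> rho l s = \e -> rho k s = \e.
Proof. by move=> hk hl; rewrite -(rho1 hl) => /(rho_le hk hl) ->; rewrite rho1 //; lia. Qed.
Lemma DM k s t : (S k <= d)%nat -> D k (s ** t) = fadd (D k s) (shift (rho k s) (D k t)).
Proof. by move=> hk; rewrite /D rhoM // -(@rho_snd k). Qed.
Lemma D1 k : (S k <= d)%nat -> D k \e = @zerof _ (tower k).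
Proof. by move=> hk; rewrite /D rho1. Qed.
Lemma DV k s : (S k <= d)%nat -> D k s^-1 = fsub (@zerof _ (tower k)) (shift (rho k s)^-1 (D k s)).
Proof. by move=> hk; rewrite /D rhoV // -(@rho_snd k). Qed.
Lemma Dx k i : (S k <= d)%nat -> (i < r)%nat -> D k (x i) = ind (i, \e).
Proof. by move=> hk hi; rewrite /D rho_x. Qed.
Lemma D_ker k s : (S k <= d)%nat -> D k s = @zerof _ (tower k) -> rho k s = \e -> rho (S k) s = \e.
Proof. by move=> hk e e'; rewrite rhoE // e e'. Qed.
Lemma D_eq1 k s : (S k <= d)%nat -> rho (S k) s = \e -> D k s = @zerof _ (tower k).
Proof. by move=> hk e; rewrite /D e. Qed.
Lemma der_rho k s : (k <= d)%nat -> derived G k s -> rho k s = \e.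
Proof. by move=> hk /(hom_der (rho_hom hk)) /tower_solvable. Qed.

Lemma D_zpow k s z : (S k <= d)%nat -> rho k s = \e -> D k (zpow s z) = fscal z (D k s).
Proof.
move=> hk e; have hk' : (k <= d)%nat by lia.
elim/Z.peano_ind: z => [|z IH|z IH]; first by rewrite /= D1.
  by rewrite zpow_succ DM // e shift1 IH; apply: fn_eq => p; rewrite /fadd /fscal; lia.
rewrite zpow_pred DM // DV // rhoV // e inv1 !shift1 IH.
by apply: fn_eq => p; rewrite /fadd /fscal /fsub /zerof; lia.
Qed.

Definition im k c := exists s, c = rho k s.
Arguments im : clear implicits.
Lemma im_1 k : (k <= d)%nat -> im k \e.
Proof. by exists \e; rewrite rho1. Qed.
Lemma im_M k a b : (k <= d)%nat -> im k a -> im k b -> im k (a ** b).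
Proof. by move=> hk [s ->] [t ->]; exists (s ** t); rewrite rhoM. Qed.
Lemma im_V k a : (k <= d)%nat -> im k a -> im k a^-1.
Proof. by move=> hk [s ->]; exists s^-1; rewrite rhoV. Qed.
Lemma im_tower_gen k i : (k <= d)%nat -> (i < r)%nat -> im k (tower_gen k i).
Proof. by move=> hk hi; exists (x i); rewrite rho_x. Qed.

Notation okr := (fun i => (i < r)%nat).
Notation finsupp_at k := (finsupp (im k) okr).

(** * Chains in the Cayley graph of a level and their boundaries *)

Section Boundary.
Variable k : nat.
Implicit Types v w : nat * tower k -> Z.

(** The sum of the [v_i (x_i - 1)], the boundary of [v] as a 1-chain of the Cayley graph.
    Multiplication by [x_i] is on the right, hence commutes with [shift]. *)
Fixpoint boundary_upto n v : unit * tower k -> Z :=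
  match n with
  | O => @zerof _ _
  | S n => fadd (boundary_upto n v) (fun c => v (n, snd c ** (tower_gen k n)^-1) - v (n, snd c))
  end.
Definition boundary v := boundary_upto r v.

Lemma bdn_add n v w : boundary_upto n (fadd v w) = fadd (boundary_upto n v) (boundary_upto n w).
Proof. by elim: n => [|n IH] //=; rewrite IH; apply: fn_eq => c; rewrite /fadd; lia. Qed.
Lemma bdn_scal n z v : boundary_upto n (fscal z v) = fscal z (boundary_upto n v).
Proof.
elim: n => [|n IH] /=; first by apply: fn_eq => c; rewrite /fscal /zerof; lia.
by rewrite IH; apply: fn_eq => c; rewrite /fadd /fscal; lia.
Qed.
Lemma boundary_sub v w : boundary (fsub v w) = fsub (boundary v) (boundary w).
Proof.
have -> : fsub v w = fadd v (fscal (-1) w) by apply: fn_eq => c; rewrite /fsub /fadd /fscal; lia.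
by rewrite /boundary bdn_add bdn_scal; apply: fn_eq => c; rewrite /fsub /fadd /fscal; lia.
Qed.
Lemma boundary_add v w : boundary (fadd v w) = fadd (boundary v) (boundary w).
Proof. exact: bdn_add. Qed.
Lemma boundary_scal z v : boundary (fscal z v) = fscal z (boundary v).
Proof. exact: bdn_scal. Qed.
Lemma boundary_shift g v : boundary (shift g v) = shift g (boundary v).
Proof.
rewrite /boundary; elim: r => [|n IH] //=; rewrite IH; apply: fn_eq => c.
by rewrite /fadd /shift /= !mulA.
Qed.
Lemma boundary_zerof : boundary (@zerof _ _) = @zerof _ _.
Proof. by rewrite /boundary; elim: r => [|n IH] //=; rewrite IH. Qed.
Lemma boundary_conv L v : boundary (conv L v) = conv L (boundary v).
Proof.
elim: L => [|[z g] L IH]; first by rewrite !conv_nil boundary_zerof.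
by rewrite !conv_cons boundary_add boundary_scal boundary_shift IH.
Qed.
Lemma boundary_ind i c : (i < r)%nat -> boundary (ind (i, c)) = fsub (ind (tt, c ** tower_gen k i)) (ind (tt, c)).
Proof.
have aux n : (n <= i)%nat -> boundary_upto n (ind (i, c)) = @zerof _ _.
  elim: n => [|n IH] hn //=; rewrite IH; first lia.
  by apply: fn_eq => c'; rewrite /fadd /zerof !ind0 //; move=> [] ?; lia.
rewrite /boundary; elim: r => [|n IH] hi; first lia.
case: (PeanoNat.Nat.eq_dec n i) => [->|ne] /=.
  rewrite aux //; apply: fn_eq => -[[] c'] /=; rewrite /fadd /fsub /zerof /=.
  rewrite (@ind_iff _ _ (i, c) (i, c' ** _) (tt, c ** tower_gen k i) (tt, c')).
    by split=> -[]; [move=> ->; rewrite !gE | move=> <-; rewrite !gE].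
  rewrite (@ind_iff _ _ (i, c) (i, c') (tt, c) (tt, c')); last lia.
  by split=> -[->].
rewrite IH; first lia.
by apply: fn_eq => c'; rewrite /fadd !(@ind0 _ (i, c)) ?Z.add_0_r //; move=> [] ?; lia.
Qed.

Definition boundary_list (L : list (Z * (nat * tower k))) : list (Z * (unit * tower k)) :=
  flat_map (fun e => [(fst e, (tt, snd (snd e) ** tower_gen k (fst (snd e)))); (- fst e, (tt, snd (snd e)))]) L.
Lemma coef_boundary_list L : Forall (good (im k) okr) L -> coef (boundary_list L) = boundary (coef L).
Proof.
elim: L => [|[z [i c]] L IH] hL; first by rewrite -[coef nil]/(@zerof _ _) boundary_zerof.
have [[hi hc] hL'] : ((i < r)%nat /\ im k c) /\ Forall (good (im k) okr) L by inversion hL.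
have -> : coef ((z, (i, c)) :: L) = fadd (fscal z (ind (i, c))) (coef L) by [].
rewrite boundary_add boundary_scal boundary_ind // -IH //.
by apply: fn_eq => c' /=; rewrite /fadd /fscal /fsub; lia.
Qed.
Lemma lin_boundary_list F L : lin F (boundary_list L) =
  lin (fun p => F (tt, snd p ** tower_gen k (fst p)) - F (tt, snd p)) L.
Proof. by elim: L => [|[z [i c]] L IH] //=; rewrite IH; lia. Qed.
(** Each edge contributes its end point with a plus and its starting point with a minus. *)
Lemma boundary_aug v M : finsupp_at k v -> boundary v = coef M -> lin (fun _ => 1%Z) M = 0.
Proof.
move=> [L gL ->]; rewrite -coef_boundary_list // => e.
rewrite -(@lin_ext _ _ (boundary_list L)); first by move=> c; rewrite e.
by rewrite lin_boundary_list /= lin_0.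
Qed.
End Boundary.

(** Fox's fundamental formula: [D k s] is the chain of a path from the identity to [rho k s]. *)
Lemma boundary_D k s : (S k <= d)%nat ->
  boundary (D k s) = fsub (ind (tt, rho k s)) (ind (tt, \e)).
Proof.
move=> hk; have hk' : (k <= d)%nat by lia.
elim/gen_ind_x: s => [i hi||s t es et|s es].
- by rewrite Dx // boundary_ind // rho_x // mul1g.
- by rewrite D1 // boundary_zerof rho1 //; apply: fn_eq => c; rewrite /fsub /zerof; lia.
- rewrite DM // boundary_add boundary_shift es et rhoM // shift_sub !shift_ind mulg1.
  by apply: fn_eq => c; rewrite /fadd /fsub; lia.
- rewrite DV // boundary_sub boundary_zerof boundary_shift es rhoV // shift_sub !shift_ind mulVg mulg1.
  by apply: fn_eq => c; rewrite /zerof /fsub; lia.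
Qed.

(** * The kernel of the Magnus homomorphism *)

Section Kernel.
Variable k : nat.
Hypothesis hk : (S k <= d)%nat.
Let hk' : (k <= d)%nat. Proof. by lia. Qed.
Hypothesis ker : forall s, rho k s = \e -> derived G k s.

Let eqv s t := derived G (S k) (s ** t^-1).
Let eqv_refl s : eqv s s. Proof. by rewrite /eqv mulgV; apply: der1. Qed.
Let eqv_sym s t : eqv s t -> eqv t s.
Proof. by move=> /derV; rewrite /eqv !gE. Qed.
Let eqv_trans s t u : eqv s t -> eqv t u -> eqv s u.
Proof. by move=> h h'; have := derM h h'; rewrite /eqv !gE. Qed.
Let eqv_mul s s' t t' : eqv s s' -> eqv t t' -> eqv (s ** t) (s' ** t').
Proof. by move=> h h'; have := derM (der_cj s h') h; rewrite /eqv /cj !gE. Qed.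
Let eqv_comm s t : derived G k s -> derived G k t -> eqv (s ** t) (t ** s).
Proof. by move=> h h'; have := der_cm h h'; rewrite /eqv /cm !gE. Qed.

Definition sec (c : tower k) : G := epsilon (inhabits \e) (fun s => c = rho k s).
Lemma secE c : im k c -> rho k (sec c) = c.
Proof. by move=> h; rewrite -(epsilon_spec (inhabits \e) _ h). Qed.
(* The closed path through the edge [(i, c)] of the Cayley graph, returning along the section. *)
Definition loop (p : nat * tower k) : G :=
  if excluded_middle_informative (okr (fst p) /\ im k (snd p))
  then sec (snd p) ** x (fst p) ** (sec (snd p ** tower_gen k (fst p)))^-1 else \e.
Lemma loopE i c : (i < r)%nat -> im k c -> loop (i, c) = sec c ** x i ** (sec (c ** tower_gen k i))^-1.
Proof. by rewrite /loop => hi hc; case: excluded_middle_informative => [//|[]]. Qed.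
Lemma loop_ker p : rho k (loop p) = \e.
Proof.
rewrite /loop; case: excluded_middle_informative => [[hi hc]|_]; last exact: rho1.
rewrite !rhoM // rhoV // rho_x // !secE ?mulgV //.
by apply: im_M => //; apply: im_tower_gen.
Qed.
Definition loops L : G := fold_sum (fun z p s => zpow (loop p) z ** s) L \e.
Lemma loops_app L L' : loops (L ++ L') = loops L ** loops L'.
Proof. by rewrite /loops; elim: L => [|e L IH] /=; rewrite ?mul1g // IH mulA. Qed.
Lemma loops_rev L : loops (rev (neg L)) = (loops L)^-1.
Proof.
elim: L => [|[z p] L IH] /=; first by rewrite /loops /= inv1.
by rewrite loops_app IH /loops /= invM mulg1 zpow_opp.
Qed.
Lemma loops_ker L : rho k (loops L) = \e.
Proof.
elim: L => [|[z p] L IH]; first exact: rho1.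
by rewrite /loops /= rhoM // -/(loops L) IH (hom_zpow (rho_hom hk')) loop_ker mulg1 zpow_e.
Qed.
Let zpow_der s z : derived G k s -> derived G k (zpow s z).
Proof.
move=> h; elim/Z.peano_ind: z => [|i IH|i IH]; first exact: der1.
  by rewrite zpow_succ; apply: derM.
by rewrite zpow_pred; apply: derM IH; apply: derV.
Qed.
Let loops_zero L : (forall p, coef L p = 0) -> eqv (loops L) \e.
Proof.
move=> h; have lk p z : derived G k (zpow (loop p) z) by apply: zpow_der; apply: ker; apply: loop_ker.
apply: (@fold_sum_zero _ _ eqv _ eqv_refl eqv_sym eqv_trans).
- by move=> z p s t hst; apply: eqv_mul.
- by move=> z p z' p' s; rewrite !gmul_assoc; apply: eqv_mul => //; apply: eqv_comm.
- by move=> z z' p s; rewrite gmul_assoc -zpow_add.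
- by move=> p s; rewrite /= mul1g.
- by move=> p s; rewrite h /= mul1g.
Qed.
Let coef_rev (L : list (Z * (nat * tower k))) : coef (rev L) = coef L.
Proof. by apply: fn_eq => p; elim: L => [|e L IH] //=; rewrite coef_app IH /=; lia. Qed.

(** Closing up every edge of the path labelled [s] from [c] by the section turns it, modulo
    [derived G (S k)], into a product of loops in which each edge occurs as often as the Fox
    derivative says. *)
Let path s c : im k c -> exists2 L, Forall (good (im k) okr) L /\ coef L = shift c (D k s) &
  eqv (sec c ** s ** (sec (c ** rho k s))^-1) (loops L).
Proof.
elim/gen_ind_x: s c => [i hi||s t IHs IHt|s IH] c hc.
- exists [(1%Z, (i, c))].
    split; first by do !constructor.
    by rewrite Dx // shift_ind mulg1; apply: fn_eq => p /=; lia.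
  by rewrite rho_x // /loops /= loopE // !mulg1.
- exists nil; first by rewrite D1.
  by rewrite rho1 // !gE.
- have [L [gL eL] hL] := IHs c hc.
  have hc' : im k (c ** rho k s) by apply: im_M => //; exists s.
  have [L' [gL' eL'] hL'] := IHt _ hc'.
  exists (L ++ L').
    split; first by apply/Forall_app.
    rewrite DM // shift_add -shiftM -eL -eL'; apply: fn_eq => p; exact: coef_app.
  have := eqv_mul hL hL'; rewrite loops_app rhoM // !gE.
  by [].
- have hc' : im k (c ** (rho k s)^-1) by apply: im_M => //; apply: im_V => //; exists s.
  have [L [gL eL] hL] := IH _ hc'.
  exists (rev (neg L)).
    split.
      apply: Forall_rev; apply/Forall_map; apply: Forall_impl gL => -[z p] [] //.
    rewrite coef_rev DV // shift_sub -shiftM -eL.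
    by apply: fn_eq => p; rewrite coef_neg /fsub /zerof /shift; lia.
  have := derV (der_cj (loops L)^-1 hL).
  rewrite loops_rev /eqv /cj rhoV // !gE.
  by [].
Qed.

(** If the Fox derivatives vanish, every loop occurs with total exponent zero; and loops lie in
    [derived G k], so they commute modulo [derived G (S k)]. *)
Lemma ker_step s : rho (S k) s = \e -> derived G (S k) s.
Proof.
move=> e; have e' := rho_le1 (PeanoNat.Nat.le_succ_diag_r k) hk e.
have [L [gL eL] hL] := path s (im_1 hk').
have h0 : eqv (loops L) \e by apply: loops_zero => p; rewrite eL D_eq1 //.
have := der_cj (sec \e)^-1 (eqv_trans hL h0).
by rewrite e' /cj !gE.
Qed.

(* Exactness of the Magnus embedding. *)
Lemma cycle_lift v : finsupp_at k v -> boundary v = @zerof _ _ -> exists2 n, rho k n = \e & D k n = v.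
Proof.
move=> [L gL ->] e; exists (loops L); first exact: loops_ker.
have aux M : Forall (good (im k) okr) M -> forall q, D k (loops M) q =
    lin (fun p => ind p q + D k (sec (snd p)) q - D k (sec (snd p ** tower_gen k (fst p))) q) M.
  elim: M => [_ q|[z [i c]] M IH hM q]; first by rewrite /loops /= D1.
  have [[hi hc] hM'] : ((i < r)%nat /\ im k c) /\ Forall (good (im k) okr) M by inversion hM.
  have lk : rho k (loop (i, c)) = \e by apply: loop_ker.
  have pk z' : rho k (zpow (loop (i, c)) z') = \e by have := loops_ker [(z', (i, c))]; rewrite /loops /= mulg1.
  rewrite /loops /= DM // pk shift1 -/(loops M) /fadd IH //=; congr (_ + _).
  rewrite D_zpow //; congr (_ * _); rewrite loopE //.
  have hc' : im k (c ** tower_gen k i) by apply: im_M => //; apply: im_tower_gen.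
  rewrite !DM // DV // rhoM // rho_x // Dx // !secE // shift_sub -shiftM mulgV shift1 shift_ind mulg1.
  by rewrite /fadd /fsub /shift /zerof; lia.
have gL' := gL; apply: fn_eq => q; rewrite aux // (lin_coef L q).
(* The contributions of the section to the loops add up to the pairing of [F] with the boundary of
   [L], which is zero. *)
pose F (p : unit * tower k) := D k (sec (snd p)) q.
have := lin_boundary_list F L; rewrite lin_zero => [c|h].
  by left; rewrite coef_boundary_list // e.
transitivity (lin (fun p => ind p q + -1 * (F (tt, snd p ** tower_gen k (fst p)) - F (tt, snd p))) L).
  by apply: eq_lin => p _; rewrite /F /=; lia.
by rewrite lin_add lin_scal -h; lia.
Qed.
End Kernel.

Lemma ker_rho k s : (k <= d)%nat -> rho k s = \e -> derived G k s.
Proof.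
elim: k s => [//|k IH] s hk e; apply: (ker_step hk _ e) => t; apply: IH; lia.
Qed.
Lemma cycle k v : (S k <= d)%nat -> finsupp_at k v -> boundary v = @zerof _ (tower k) ->
  exists2 n, rho k n = \e & D k n = v.
Proof. by move=> hk; apply: cycle_lift => //. Qed.
Lemma rho_d_inj s t : rho d s = rho d t -> s = t.
Proof.
move=> e; apply: mulV_eq1; have [sol _] := hfree; apply: sol; apply: ker_rho => //.
by rewrite rhoM // rhoV // e mulgV.
Qed.

(** * Right orders on the images *)

Section Order.
Variables (k : nat) (lt : tower k -> tower k -> Prop).
Hypothesis hk : (k <= d)%nat.
Hypothesis hlt : right_order (im k) lt.
Let keylt (p q : nat * tower k) := lt (snd p) (snd q) \/ (snd p = snd q /\ (fst p < fst q)%nat).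
Let keylt_irr p : ~ keylt p p.
Proof. by case=> [/(lt_irr hlt)|[_]] //; lia. Qed.
Let keylt_trans p q u : keylt p q -> keylt q u -> keylt p u.
Proof.
move=> [h|[e h]] [h'|[e' h']]; rewrite /keylt.
- by left; apply: (lt_trans hlt) h h'.
- by left; rewrite -e'.
- by left; rewrite e.
- by right; rewrite e e'; split=> //; lia.
Qed.
Let keylt_total p q : im k (snd p) -> im k (snd q) -> p = q \/ keylt p q \/ keylt q p.
Proof.
case: p q => [i c] [j c'] hp hq; rewrite /keylt /=.
case: (lt_total hlt hp hq) => /= [->|]; last by case; auto.
by case: (Compare_dec.lt_eq_lt_dec i j) => [[h|->]|h]; auto.
Qed.
Let posf (v : nat * tower k -> Z) := exists2 p, im k (snd p) /\ 0 < v p &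
  forall q, im k (snd q) -> keylt p q -> v q = 0.
Let posf_add v w : posf v -> posf w -> posf (fadd v w).
Proof.
move=> [p [ip hp] mp] [q [iq hq] mq]; case: (keylt_total ip iq) => [e|[h|h]].
- subst q; exists p; first by split=> //; rewrite /fadd; lia.
  by move=> u iu hs; rewrite /fadd mp // mq.
- exists q; first by rewrite /fadd mp.
  by move=> u iu hs; rewrite /fadd mq // mp //; apply: keylt_trans hs.
- exists p; first by rewrite /fadd mq //; split=> //; lia.
  by move=> u iu hs; rewrite /fadd mp // mq //; apply: keylt_trans hs.
Qed.
Let posf_dec v : finsupp_at k v -> v = @zerof _ _ \/ posf v \/ posf (fsub (@zerof _ _) v).
Proof.
move=> hv; case: (classic (v = @zerof _ _)) => [|ne]; [by left|right].
have [L gL eL] := hv.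
have [|p _ [hp mp]] := @maximal_exists _ keylt (fun p => v p <> 0) (map snd L) keylt_irr keylt_trans.
  have [p hp] : exists p, v p <> 0 by apply: not_all_ex_not => h; apply: ne; apply: fn_eq.
  by exists p => //; apply: coef_in; rewrite -eL.
have ip : im k (snd p) by case: p hp {mp} => i c /(finsupp_supp hv) [].
have {}mp q : im k (snd q) -> keylt p q -> v q = 0.
  move=> _ h; apply: NNPP => hq; apply: (mp q) => //.
  by apply: coef_in; rewrite -eL.
case: (Z_lt_le_dec 0 (v p)) => h; [left|right]; exists p => //.
  by split=> //; rewrite /fsub /zerof; lia.
by move=> q iq hq; rewrite /fsub mp.
Qed.
Hypothesis hk1 : (S k <= d)%nat.
Hypothesis Dfs : forall s, finsupp_at k (D k s).

(** Lexicographic: the base comes before the sign of the leading coefficient of [b ** a^-1]. This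
    quotient is unchanged by multiplication on the right, whereas multiplication on the left shifts
    keys on the left, which the order of the base need not respect. *)
Definition wlt (a b : tower (S k)) : Prop :=
  lt (snd a) (snd b) \/ (snd a = snd b /\ posf (fst (b ** a^-1))).
Let fst_div s t : rho k s = rho k t -> fst (rho (S k) t ** (rho (S k) s)^-1) = fsub (D k t) (D k s).
Proof.
move=> e; rewrite !rhoE //= e shift_sub -shiftM mulgV shift1.
by apply: fn_eq => p; rewrite /fadd /fsub /shift /zerof; lia.
Qed.
Lemma wlt_order : right_order (im (S k)) wlt.
Proof.
split.
- exact: im_1.
- by move=> a b; apply: im_M.
- by move=> a; apply: im_V.
- move=> a [/(lt_irr hlt)|[_]] //; rewrite mulgV.
  by case=> p [_] /=; rewrite /zerof; lia.
- move=> a b c [h|[e h]] [h'|[e' h']]; rewrite /wlt.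
  + by left; apply: (lt_trans hlt) h h'.
  + by left; rewrite -e'.
  + by left; rewrite e.
  + right; rewrite e e'; split=> //.
    have -> : c ** a^-1 = (c ** b^-1) ** (b ** a^-1) by rewrite !gE.
    have -> : fst ((c ** b^-1) ** (b ** a^-1)) = fadd (fst (c ** b^-1)) (fst (b ** a^-1)).
      by rewrite /= e' mulgV !shift1.
    exact: posf_add.
- move=> a b c [h|[e h]]; [left|right].
    by apply: (lt_mulr hlt).
  by split; [rewrite /= e | rewrite invM mulA mulKVg].
- move=> _ _ [s ->] [t ->]; rewrite /wlt !rho_snd //.
  case: (lt_total hlt (ex_intro _ s eq_refl) (ex_intro _ t eq_refl)) => [e|[h|h]]; auto.
  have [h|[h|h]] := posf_dec (finsupp_sub (Dfs t) (Dfs s)).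
  + left; apply: rho_inj => //; apply: fn_eq => p; have := eq_fn h p; rewrite /fsub /zerof; lia.
  + by right; left; right; split=> //; rewrite fst_div.
  + right; right; right; split=> //; rewrite fst_div //.
    move: h; congr posf; apply: fn_eq => p; rewrite /fsub /zerof; lia.
Qed.
End Order.

Lemma D_fs_of k lt s : right_order (im k) lt -> (S k <= d)%nat -> finsupp_at k (D k s).
Proof.
move=> hlt hk; have hk' : (k <= d)%nat by lia.
elim/gen_ind_x: s => [i hi||s t hs ht|s hs].
- by rewrite Dx //; apply: finsupp_ind => //; apply: im_1.
- by rewrite D1 //; apply: finsupp_zerof.
- by rewrite DM //; apply: finsupp_add => //; apply: (finsupp_shift hlt) => //; exists s.
- rewrite DV //; apply: finsupp_sub; first exact: finsupp_zerof.
  by apply: (finsupp_shift hlt) => //; apply: im_V => //; exists s.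
Qed.
Lemma rho_order k : (k <= d)%nat -> exists lt, right_order (im k) lt.
Proof.
elim: k => [|k IH] hk.
  have u (a b : tower 0) : a = b by case: a; case: b.
  have i (a : tower 0) : im 0 a by exists \e; apply: u.
  by exists (fun _ _ => False); split=> *; first [exact: i | by [] | by left; apply: u].
have [lt hlt] := IH (PeanoNat.Nat.lt_le_incl _ _ hk); exists (wlt lt).
by apply: wlt_order => //; [lia|move=> s; apply: D_fs_of hlt _].
Qed.
Lemma D_fs k s : (S k <= d)%nat -> finsupp_at k (D k s).
Proof. by move=> hk; have [lt hlt] := rho_order (PeanoNat.Nat.lt_le_incl _ _ hk); apply: D_fs_of hlt _. Qed.

(** * Commutators in consecutive levels *)

Definition indep k a b := forall i j, rho k (zpow a i ** zpow b j) = \e -> i = 0 /\ j = 0.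

Lemma rho_cm k a b : (k <= d)%nat -> rho k (cm a b) = cm (rho k a) (rho k b).
Proof. by move=> hk; apply: hom_cm; apply: rho_hom. Qed.
Lemma rho_cj k a b : (k <= d)%nat -> rho k (cj a b) = cj (rho k a) (rho k b).
Proof. by move=> hk; apply: hom_cj; apply: rho_hom. Qed.
Lemma rho_zpow k a i : (k <= d)%nat -> rho k (zpow a i) = zpow (rho k a) i.
Proof. by move=> hk; apply: hom_zpow; apply: rho_hom. Qed.
Lemma cj_ker k a b : (k <= d)%nat -> rho k b = \e -> rho k (cj a b) = \e.
Proof. by move=> hk e; rewrite rho_cj // e /cj !gE. Qed.
Lemma D_cm k a b : (S k <= d)%nat -> rho k a ** rho k b = rho k b ** rho k a ->
  D k (cm a b) = fsub (fsub (D k a) (shift (rho k b) (D k a))) (fsub (D k b) (shift (rho k a) (D k b))).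
Proof.
by move=> hk e; rewrite {1}/D rho_cm // wreath_cm !rho_snd.
Qed.
Lemma D_cj k a b : (S k <= d)%nat -> rho k b = \e -> D k (cj a b) = shift (rho k a) (D k b).
Proof.
move=> hk e; have hk' : (k <= d)%nat by lia.
rewrite /cj !DM // !DV // !shift_sub -!shiftM !rhoM // e mulg1 mulgV shift1.
by apply: fn_eq => p; rewrite /fadd /fsub /zerof /shift; lia.
Qed.
Lemma D_mul_ker k a b : (S k <= d)%nat -> rho k a = \e -> D k (a ** b) = fadd (D k a) (D k b).
Proof. by move=> hk e; rewrite DM // e shift1. Qed.
Lemma ker_comm k a b : (S k <= d)%nat -> rho k a = \e -> rho k b = \e ->
  rho (S k) a ** rho (S k) b = rho (S k) b ** rho (S k) a.
Proof.
move=> hk ea eb; have hk' : (k <= d)%nat by lia.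
rewrite -!rhoM //; apply: rho_inj => //; last by rewrite !rhoM // ea eb.
by rewrite !D_mul_ker //; apply: fn_eq => p; rewrite /fadd; lia.
Qed.

Lemma im_rho k s : im k (rho k s). Proof. by exists s. Qed.
Lemma no_zero_div k (J : Type) (ok : J -> Prop) L (v : J * tower k -> Z) : (k <= d)%nat ->
  Forall (fun e => im k (snd e)) L -> finsupp (im k) ok v -> conv L v = @zerof _ _ -> v <> @zerof _ _ ->
  forall g, coef L g = 0.
Proof. by move=> hk hL hv; have [lt hlt] := rho_order hk; apply: (no_zero_divisors hlt hL hv). Qed.
Lemma fixed0 k (J : Type) (ok : J -> Prop) s (v : J * tower k -> Z) : (k <= d)%nat ->
  rho k s <> \e -> finsupp (im k) ok v -> v = shift (rho k s) v -> v = @zerof _ _.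
Proof. by move=> hk hs; have [lt hlt] := rho_order hk; apply: (shift_fixed hlt) => //; apply: im_rho. Qed.
Lemma rho_tf k s i : (k <= d)%nat -> i <> 0 -> rho k (zpow s i) = \e -> rho k s = \e.
Proof.
move=> hk hi; rewrite rho_zpow //; have [lt hlt] := rho_order hk.
by apply: (torsion_free hlt) hi; apply: im_rho.
Qed.
Lemma division k a b p q : (k <= d)%nat -> rho k a ** rho k b = rho k b ** rho k a -> indep k a b ->
  finsupp_at k p -> finsupp_at k q -> fsub p (shift (rho k b) p) = fsub q (shift (rho k a) q) ->
  exists2 v, finsupp_at k v & p = fsub v (shift (rho k a) v) /\ q = fsub v (shift (rho k b) v).
Proof.
move=> hk ab ind; have [lt hlt] := rho_order hk.
apply: (coprime_division hlt) => //; try exact: im_rho.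
by move=> i j e; apply: ind; rewrite rhoM // !rho_zpow.
Qed.
Lemma finsupp_shiftk k (J : Type) (ok : J -> Prop) s (v : J * tower k -> Z) : (k <= d)%nat ->
  finsupp (im k) ok v -> finsupp (im k) ok (shift (rho k s) v).
Proof. by move=> hk; have [lt hlt] := rho_order hk; apply: (finsupp_shift hlt); apply: im_rho. Qed.
Lemma finsupp_convk k (J : Type) (ok : J -> Prop) L (v : J * tower k -> Z) : (k <= d)%nat ->
  Forall (fun e => im k (snd e)) L -> finsupp (im k) ok v -> finsupp (im k) ok (conv L v).
Proof. by move=> hk; have [lt hlt] := rho_order hk; apply: (finsupp_conv hlt). Qed.
Notation finsupp_unit k := (finsupp (im k) (fun _ : unit => True)).
Lemma boundary_fs k v : (k <= d)%nat -> finsupp_at k v -> finsupp_unit k (boundary v).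
Proof.
move=> hk [L gL ->]; exists (boundary_list L); last by rewrite coef_boundary_list.
elim: gL => [|[z [i c]] M [hi hc] _ IH] //=.
by do !constructor => //=; apply: im_M => //; apply: im_tower_gen.
Qed.
Lemma conv_ev1 k (L : list (Z * tower k)) :
  conv L (ind (tt, \e)) = coef (map (fun e => (fst e, (tt, snd e))) L).
Proof.
elim: L => [|[z g] L IH] //=; rewrite conv_cons IH shift_ind mulg1.
by apply: fn_eq.
Qed.

(* If [p = (1 - w) v] has boundary [P (w - 1)] then the boundary of [v] is [- P],
   but boundaries have augmentation zero. *)
Lemma aug_zero k w P p v : (k <= d)%nat -> finsupp_at k v -> rho k w <> \e ->
  p = fsub v (shift (rho k w) v) -> Forall (fun e => im k (snd e)) P ->
  (forall g, In g (map snd P) -> g ** rho k w = rho k w ** g) ->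
  boundary p = conv P (fsub (ind (tt, rho k w)) (ind (tt, \e))) -> lin (fun _ => 1%Z) P = 0.
Proof.
move=> hk hv hw -> iP cP; rewrite boundary_sub boundary_shift conv_sub => e.
have e1 : conv P (ind (tt, rho k w)) = shift (rho k w) (conv P (ind (tt, \e))).
  by rewrite -conv_shift // shift_ind mulg1.
have hu : fadd (boundary v) (conv P (ind (tt, \e))) = @zerof _ _.
  apply: (fixed0 (ok := fun _ => True) hk hw).
    apply: finsupp_add; first exact: boundary_fs.
    by apply: finsupp_convk => //; apply: finsupp_ind => //; apply: im_1.
  rewrite shift_add -e1; apply: fn_eq => q; have := eq_fn e q; rewrite /fadd /fsub; lia.
pose M := neg (map (fun e => (fst e, (tt, snd e))) P).
have : lin (fun _ => 1%Z) M = 0.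
  apply: (boundary_aug hv); apply: fn_eq => q; rewrite /M coef_neg -conv_ev1.
  by have := eq_fn hu q; rewrite /fadd /zerof; lia.
by rewrite /M lin_neg (lin_map (fun g => (tt, g))); lia.
Qed.

(** Otherwise coprimality gives [D k a = (1 - a) v]. The boundary of the left side is [a - 1], so
    that of [v] would be [-1], which has nonzero augmentation. *)
Lemma cm_neq1 k a b : (S k <= d)%nat -> rho k a ** rho k b = rho k b ** rho k a -> indep k a b ->
  rho (S k) (cm a b) <> \e.
Proof.
move=> hk ab hab /D_eq1 e; have hk' : (k <= d)%nat by lia.
have {}e := e hk; rewrite D_cm // in e.
have {}e : fsub (D k a) (shift (rho k b) (D k a)) = fsub (D k b) (shift (rho k a) (D k b)).
  by apply: fn_eq => p; have := eq_fn e p; rewrite /fsub /zerof; lia.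
have [v hv [ea _]] := division hk' ab hab (D_fs _ hk) (D_fs _ hk) e.
have ha : rho k a <> \e.
  by move=> h; have [//] : 1%Z = 0 /\ 0 = 0; apply: hab; rewrite zpow_1 mulg1.
suff : lin (fun _ => 1%Z) [(1%Z, gone (tower k))] = 0 by [].
apply: (aug_zero hk' hv ha ea).
- by do !constructor; apply: im_1.
- by move=> g [<-|[]]; rewrite !gE.
- by rewrite conv_one shift1 boundary_D.
Qed.
(** A relation means that [i + j w] annihilates the nonzero element [D k a]; as [w] is not 1 at
    level [k], both coefficients vanish. *)
Lemma cj_indep k a w : (S k <= d)%nat -> rho k a = \e -> rho (S k) a <> \e -> rho k w <> \e ->
  indep (S k) a (cj w a).
Proof.
move=> hk ea na nw i j; have hk' : (k <= d)%nat by lia.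
have ec : rho k (cj w a) = \e by apply: cj_ker.
have ez s z : rho k s = \e -> rho k (zpow s z) = \e.
  by move=> es; rewrite rho_zpow // es zpow_e.
move=> /(D_eq1 hk); rewrite D_mul_ker ?ez // !D_zpow // D_cj // => e.
pose L := [(i, gone (tower k)); (j, rho k w)].
have iL : Forall (fun e => im k (snd e)) L by do !constructor; [apply: im_1 | apply: im_rho].
have e0 : conv L (D k a) = @zerof _ _.
  by apply: fn_eq => p; have := eq_fn e p; rewrite /conv /= shift1 /fadd /fscal; lia.
have ne : D k a <> @zerof _ _ by move=> h; apply: na; apply: D_ker.
have h := no_zero_div hk' iL (D_fs _ hk) e0 ne.
have := h \e; have := h (rho k w); rewrite /= !ind1 !ind0 //; first by move=> h'; apply: nw.
by lia.
Qed.
(** By coprimality the Fox derivatives differ by [(1 - a) v] and [(1 - b) v]. Agreement at level [k]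
    makes [v] a cycle, hence the derivative of some [n], and conjugation by [n] adds [(1 - s) v] to
    [D k s]. *)
Lemma same_cm_conj k a b a' b' : (S k <= d)%nat ->
  rho k a ** rho k b = rho k b ** rho k a -> indep k a b ->
  rho k a' = rho k a -> rho k b' = rho k b -> rho (S k) (cm a' b') = rho (S k) (cm a b) ->
  exists n, rho k n = \e /\ rho (S k) a' = rho (S k) (cj n a) /\ rho (S k) b' = rho (S k) (cj n b).
Proof.
move=> hk ab hab ea eb /(rho_proj hk) [e _]; have hk' : (k <= d)%nat by lia.
rewrite !D_cm ?ea ?eb // in e.
have fsd s t : finsupp_at k (fsub (D k s) (D k t)) by apply: finsupp_sub; apply: D_fs.
have {}e : fsub (fsub (D k a') (D k a)) (shift (rho k b) (fsub (D k a') (D k a))) =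
           fsub (fsub (D k b') (D k b)) (shift (rho k a) (fsub (D k b') (D k b))).
  by apply: fn_eq => p; have := eq_fn e p; rewrite !shift_sub /fsub; lia.
have [v hv [eva evb]] := division hk' ab hab (fsd _ _) (fsd _ _) e.
have ha : rho k a <> \e.
  by move=> h; have [//] : 1%Z = 0 /\ 0 = 0; apply: hab; rewrite zpow_1 mulg1.
have bv : boundary v = @zerof _ _.
  apply: (fixed0 (ok := fun _ => True) hk' ha); first exact: boundary_fs.
  have : boundary (fsub (D k a') (D k a)) = @zerof _ _.
    by rewrite boundary_sub !boundary_D // ea; apply: fn_eq => p; rewrite /fsub /zerof; lia.
  rewrite eva boundary_sub boundary_shift => h; apply: fn_eq => p; have := eq_fn h p; rewrite /fsub /zerof; lia.
have [n en Dn] := cycle hk hv bv.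
have Dcj s : D k (cj n s) = fadd (D k s) (fsub v (shift (rho k s) v)).
  rewrite /cj !DM // DV // !rhoM // en inv1 mul1g !shift1 Dn shift_sub shift_zerof.
  by apply: fn_eq => p; rewrite /fadd /fsub /zerof; lia.
exists n; split=> //; split; apply: rho_inj => //; try by rewrite rho_cj // en /cj !gE.
  by rewrite Dcj -eva; apply: fn_eq => p; rewrite /fadd /fsub; lia.
by rewrite Dcj -evb; apply: fn_eq => p; rewrite /fadd /fsub; lia.
Qed.
Lemma ker_comm_trivial k c w : (S k <= d)%nat -> rho k c = \e -> rho k w <> \e ->
  rho (S k) (cj w c) = rho (S k) c -> rho (S k) c = \e.
Proof.
move=> hk ec nw /(rho_proj hk) [e _]; apply: D_ker => //.
by apply: (fixed0 _ nw (D_fs _ hk)); [lia | rewrite -D_cj].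
Qed.

(* [ext_theta] defines a cocycle on level [S k] whose value on the commutator of two
   elements of the kernel of level [k] is a 2x2 minor of their Fox derivatives. *)
Section Exterior.
Variables (k : nat) (i0 i1 : nat) (c0 c1 : tower k).
Hypothesis hk : (S (S k) <= d)%nat.
Let hk1 : (S k <= d)%nat. Proof. by lia. Qed.
Let hk0 : (k <= d)%nat. Proof. by lia. Qed.
Let W := wreath unit (tower (S k)).

Definition ext_theta (i : nat) : unit * tower (S k) -> Z := fun p =>
  ind (i, \e) (i0, snd (snd p) ** c0) * fst (snd p) (i1, snd (snd p) ** c1).

(** On generators the value is linear in the function part of its argument, with slope a Fox
    derivative, and the cocycle rule extends this to all [s]. Unrestricted supports admit
    [ext_theta], which depends on the coefficients of its argument. *)
Lemma ext_hom : exists2 Psi : G -> W, is_hom G W Psi &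
  (forall s, snd (Psi s) = rho (S k) s) /\
  (forall s (f f' : nat * tower k -> Z) (c : tower k),
    fst (Psi s) (tt, (@fadd nat (tower k) f f', c)) - fst (Psi s) (tt, (f, c)) =
      D k s (i0, c ** c0) * f' (i1, c ** c1)).
Proof.
have [Psi [hPsi Px]] := @lift W (fun i => (ext_theta i, tower_gen (S k) i)) _
  (solvable_wreath (@tower_solvable (S k))) hk.
exists Psi => //.
have sP s : snd (Psi s) = rho (S k) s.
  apply: (hom_x_eq (p := fun s => snd (Psi s)) (comp_hom hPsi (@snd_hom _ _)) (rho_hom hk1)) => i hi.
  by rewrite Px // rho_x.
split=> //; elim/gen_ind_x => [i hi||s t hs ht|s hs] f f' c.
- rewrite Px // Dx //; apply: (_ : forall a y z : Z, a * (y + z) - a * y = a * z); lia.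
- by rewrite hom1 // D1 //= /zerof; lia.
- set A : nat * tower k -> Z := fsub (@zerof _ _) (shift (rho k s)^-1 (D k s)).
  have := ht (fadd A (shift (rho k s)^-1 f)) (shift (rho k s)^-1 f') ((rho k s)^-1 ** c).
  have -> : fadd (fadd A (shift (rho k s)^-1 f)) (shift (rho k s)^-1 f') = fadd A (shift (rho k s)^-1 (fadd f f')).
    by apply: fn_eq => p; rewrite /fadd /shift; lia.
  rewrite {3}/shift /= !gE => et.
  have ee g : fst (Psi (s ** t)) (tt, (g, c)) =
      fst (Psi s) (tt, (g, c)) + fst (Psi t) (tt, (fadd A (shift (rho k s)^-1 g), (rho k s)^-1 ** c)).
    by rewrite hPsi /= sP rhoE.
  have aux (a b a' b' y z w : Z) : a - a' = y * w -> b - b' = z * w -> (a + b) - (a' + b') = (y + z) * w by lia.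
  by rewrite !ee DM //; apply: aux (hs f f' c) et.
- have ee g : fst (Psi s^-1) (tt, (g, c)) = - fst (Psi s) (tt, (fadd (D k s) (shift (rho k s) g), rho k s ** c)).
    rewrite homV // -[LHS]/(0 - fst (Psi s) (tt, (snd (Psi s))^-1^-1 ** (g, c))).
    by rewrite sP invK rhoE.
  have := hs (fadd (D k s) (shift (rho k s) f)) (shift (rho k s) f') (rho k s ** c).
  have -> : fadd (fadd (D k s) (shift (rho k s) f)) (shift (rho k s) f') = fadd (D k s) (shift (rho k s) (fadd f f')).
    by apply: fn_eq => p; rewrite /fadd /shift; lia.
  rewrite !ee DV // {3}/shift /= !gE => es.
  have aux (a b y w : Z) : a - b = y * w -> - a - - b = (0 - y) * w by lia.
  by apply: aux; rewrite /shift /= invK; apply: es.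
Qed.
End Exterior.

(** [Psi] kills [derived G (S (S k))], so level [S (S k)] determines its value on a commutator. By
    [wreath_cm] this value is a difference of two increments, each a product of two Fox
    coefficients. *)
Lemma exterior k a b u v p q : (S (S k) <= d)%nat ->
  rho k a = \e -> rho k b = \e -> rho k u = \e -> rho k v = \e ->
  rho (S (S k)) (cm u v) = rho (S (S k)) (cm a b) ->
  D k u p * D k v q - D k v p * D k u q = D k a p * D k b q - D k b p * D k a q.
Proof.
case: p q => i0 c0 [i1 c1] hk ea eb eu coef e.
have hk1 : (S k <= d)%nat by lia.
have hk0 : (k <= d)%nat by lia.
have [Psi hPsi [sP hE]] := ext_hom i0 i1 c0 c1 hk.
have key s t : rho k s = \e -> rho k t = \e -> fst (Psi (cm s t)) (tt, \e) =
    D k s (i0, c0) * D k t (i1, c1) - D k t (i0, c0) * D k s (i1, c1).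
  have half s' t' : rho k s' = \e -> rho k t' = \e -> fst (Psi s') (tt, \e) - fst (Psi s') (tt, (rho (S k) t')^-1) =
      D k s' (i0, c0) * D k t' (i1, c1).
    move=> es et; have := hE s' (fsub (@zerof _ _) (D k t')) (D k t') \e; rewrite !mul1g => <-.
    have -> : gone (tower (S k)) = (fadd (fsub (@zerof _ _) (D k t')) (D k t'), \e).
      by congr (_, _); apply: fn_eq => p; rewrite /fadd /fsub /zerof; lia.
    by rewrite rhoE // et /= /wreath_inv /= inv1 shift1.
  move=> es et.
  have c : snd (Psi s) ** snd (Psi t) = snd (Psi t) ** snd (Psi s) by rewrite !sP; apply: ker_comm.
  have ecm : Psi (cm s t) = cm (Psi s) (Psi t) by exact: hom_cm.
  have := half s t es et; have := half t s et es.
  rewrite ecm (wreath_cm c) /fsub !sP => <- <-.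
  have sme (g : tower (S k)) (w : unit * tower (S k) -> Z) : shift g w (tt, \e) = w (tt, g^-1).
    by rewrite -[LHS]/(w (tt, g^-1 ** \e)) mulg1.
  by rewrite !sme.
rewrite -!key //.
suff -> : Psi (cm u v) = Psi (cm a b) by [].
apply: mulV_eq1; rewrite -homV // -hPsi.
apply: (@solvable_wreath unit _ (S k) (@tower_solvable (S k))); apply: (hom_der hPsi).
by apply: ker_rho => //; rewrite rhoM // rhoV // e mulgV.
Qed.

(** With a nonzero minor [Dl], Cramer's rule expresses [U] and its translate by [X] through [A] and
    [w A], with coefficients of determinant [Dl * Dl]. Cancelling [A] leaves
    [l X + m X w = l' + m' w] in the group ring. Comparison of supports leaves only [X = w], and
    then [m = 0] and [l = Dl] or [l = - Dl]. *)
Lemma cm_cj_sign k a w u X : (S (S k) <= d)%nat ->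
  rho k a = \e -> rho (S k) a <> \e -> rho k w <> \e -> rho k u = \e ->
  rho (S (S k)) (cm u (cj X u)) = rho (S (S k)) (cm a (cj w a)) ->
  D k u = D k a \/ D k u = fscal (-1) (D k a).
Proof.
move=> hk ea na nw eu e.
have hk1 : (S k <= d)%nat by lia.
have hk0 : (k <= d)%nat by lia.
have ext p q := @exterior k a (cj w a) u (cj X u) p q hk ea (cj_ker _ hk0 ea) eu (cj_ker _ hk0 eu) e.
rewrite !D_cj // in ext.
set A := D k a in ext *; set U := D k u in ext *; set B := shift _ A in ext; set V := shift _ U in ext.
have fsA : finsupp_at k A by apply: D_fs.
have A0 : A <> @zerof _ _ by move=> h; apply: na; apply: D_ker.
have nzA L : Forall (fun e => im k (snd e)) L -> conv L A = @zerof _ _ -> forall g, coef L g = 0.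
  by move=> hL hc; apply: no_zero_div hL fsA hc A0.
(* If all minors vanished, [A p w - B p] would annihilate [A] for every [p]. *)
have [p [q dpq]] : exists p q, A p * B q - B p * A q <> 0.
  apply: NNPP => no; have [p hp] : exists p, A p <> 0.
    by apply: not_all_ex_not => h; apply: A0; apply: fn_eq.
  have := nzA [(A p, rho k w); (- B p, \e)] _ _ (rho k w); rewrite /= ind1 ind0; first by auto.
  move=> h; apply: hp; suff : A p * 1 + (- B p * 0 + 0) = 0 by lia.
  apply: h; first by do !constructor; [apply: im_rho | apply: im_1].
  apply: fn_eq => q; rewrite /conv /= shift1 -/B /zerof; apply: NNPP => h; apply: no; exists p, q; lia.
set Dl := A p * B q - B p * A q in dpq.
have eD := ext p q; rewrite -/Dl in eD.
pose l := U p * B q - U q * B p; pose m := U q * A p - U p * A q.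
pose l' := V p * B q - V q * B p; pose m' := V q * A p - V p * A q.
have eU (s : nat * tower k) : Dl * U s = l * A s + m * B s.
  have := ext s q; have := ext s p; rewrite /l /m -eD => h1 h2.
  have -> : (U p * V q - V p * U q) * U s = U p * (U s * V q - V s * U q) - U q * (U s * V p - V s * U p) by ring.
  by rewrite h1 h2; ring.
have eV (s : nat * tower k) : Dl * V s = l' * A s + m' * B s.
  have := ext s q; have := ext s p; rewrite /l' /m' -eD => h1 h2.
  have -> : (U p * V q - V p * U q) * V s = V p * (U s * V q - V s * U q) - V q * (U s * V p - V s * U p) by ring.
  by rewrite h1 h2; ring.
have det : l * m' - l' * m = Dl * Dl.
  by rewrite -{1}eD /l /m /l' /m' /Dl; ring.
have h := nzA [(l, rho k X); (m, rho k X ** rho k w); (- l', \e); (- m', rho k w)] _ _.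
have {}h g : l * ind (rho k X) g + m * ind (rho k X ** rho k w) g = l' * ind \e g + m' * ind (rho k w) g.
  suff : coef [(l, rho k X); (m, rho k X ** rho k w); (- l', \e); (- m', rho k w)] g = 0 by rewrite /=; lia.
  apply: h.
    by do !constructor; try exact: im_rho; [apply: im_M => //; apply: im_rho | apply: im_1].
  apply: fn_eq => s; rewrite /conv /= shift1 shiftM -/B /zerof.
  have := eV s; have := eU (fst s, (rho k X)^-1 ** snd s); rewrite -[U (_, _)]/(V s).
  by rewrite -[A (_, _)]/(shift (rho k X) A s) -[B (_, _)]/(shift (rho k X) B s); lia.
have X_Xw : rho k X ** rho k w <> rho k X by move=> h'; apply: nw; apply: (@mulgI _ (rho k X)); rewrite mulg1.
have w2 : rho k w ** rho k w <> \e.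
  move=> h'; apply: nw; apply: (@rho_tf k w 2) => //.
  by rewrite -[2%Z]/(1 + 1)%Z zpow_add zpow_1 rhoM.
have := h (rho k X); have := h (rho k X ** rho k w); rewrite !ind1 (ind0 X_Xw) (ind0 (fun h' => X_Xw (eq_sym h'))).
case: (classic (rho k X = \e)) => [->|X1].
  rewrite mul1g !ind1 !(ind0 nw) !(ind0 (fun h' => nw (eq_sym h'))); nia.
rewrite (ind0 (fun h' => X1 (eq_sym h'))).
case: (classic (rho k X = rho k w)) => [->|Xw].
  rewrite !ind1 (ind0 (fun h' => w2 (eq_sym h'))) ind0; last move=> em el.
    by move=> h'; apply: nw; apply: (@mulgI _ (rho k w)); rewrite mulg1.
  have [hl|hl] : l = Dl \/ l = - Dl by nia.
    by left; apply: fn_eq => s; have := eU s; nia.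
  by right; apply: fn_eq => s; have := eU s; rewrite /fscal; nia.
(* Here [l = 0], and either [X w = 1] and the determinant is [- m * m], or [m = 0]; neither gives
   the positive number [Dl * Dl]. *)
rewrite (ind0 (fun h' => Xw (eq_sym h'))) (@ind0 _ (rho k w) (rho k X ** rho k w)).
  by move=> h'; apply: X1; apply: (@mulIg _ (rho k w)); rewrite mul1g.
rewrite /ind; case: eqd => _; nia.
Qed.

Lemma hom_rho k (Phi : G -> G) s t : (k <= d)%nat -> is_hom G G Phi ->
  rho k s = rho k t -> rho k (Phi s) = rho k (Phi t).
Proof.
move=> hk hP e; apply: mulV_eq1; rewrite -rhoV // -rhoM // -homV // -hP.
apply: der_rho => //; apply: (hom_der hP); apply: ker_rho => //.
by rewrite rhoM // rhoV // e mulgV.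
Qed.
Lemma rho0 s : rho 0 s = \e.
Proof. by case: (rho 0 s). Qed.
Lemma rho1_comm s t : (1 <= d)%nat -> rho 1 s ** rho 1 t = rho 1 t ** rho 1 s.
Proof. by move=> hd; apply: (@ker_comm 0) => //; apply: rho0. Qed.
Lemma indep_neq1 k a b : (k <= d)%nat -> indep k a b -> rho k a <> \e.
Proof.
by move=> hk h e; have [//] : 1%Z = 0 /\ 0 = 0; apply: h; rewrite zpow_1 mulg1.
Qed.

(** The formula for [D k (cm w q)] rearranges the equation to [(1 - q) j P D w = (1 - w) u].
    Coprimality makes [j P D w] a multiple of [1 - w], and its boundary then forces the augmentation
    of [j P] to vanish. *)
Lemma commutator_not_divisible k w q P v j : (S k <= d)%nat ->
  rho k w ** rho k q = rho k q ** rho k w -> indep k w q ->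
  Forall (fun e => im k (snd e)) P ->
  (forall g, In g (map snd P) -> g ** rho k w = rho k w ** g /\ g ** rho k q = rho k q ** g) ->
  finsupp_at k v -> fscal j (conv P (D k (cm w q))) = fsub v (shift (rho k w) v) ->
  lin (fun _ => 1%Z) P * j = 0.
Proof.
move=> hk cwq hi iP cP hv e; have hk' : (k <= d)%nat by lia.
pose p := fscal j (conv P (D k w)).
pose u := fadd v (fscal j (conv P (D k q))).
have fp : finsupp_at k p by apply: finsupp_scal; apply: finsupp_convk => //; apply: D_fs.
have fu : finsupp_at k u by apply: finsupp_add => //; apply: finsupp_scal; apply: finsupp_convk => //; apply: D_fs.
have cw (v' : nat * tower k -> Z) : conv P (shift (rho k w) v') = shift (rho k w) (conv P v').
  by apply: conv_shift => h /cP [].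
have cq (v' : nat * tower k -> Z) : conv P (shift (rho k q) v') = shift (rho k q) (conv P v').
  by apply: conv_shift => h /cP [].
have eq : fsub p (shift (rho k q) p) = fsub u (shift (rho k w) u).
  move: e; rewrite D_cm // !conv_sub cw cq => e; apply: fn_eq => s; have := eq_fn e s.
  by rewrite /p /u /fsub /fadd /fscal /shift /=; lia.
have [v' hv' [ep _]] := division hk' cwq hi fp fu eq.
pose Pj := map (fun e => (j * fst e, snd e)) P.
have cPj (J : Type) (v'' : J * tower k -> Z) : conv Pj v'' = fscal j (conv P v'').
  by apply: fn_eq => s; rewrite /conv /Pj /fscal; elim: (P) => [|e' L IH] /=; lia.
have -> : lin (fun _ => 1%Z) P * j = lin (fun _ => 1%Z) Pj.
  by rewrite /Pj; elim: (P) => [|e' L IH] //=; rewrite -IH; lia.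
apply: (aug_zero hk' hv' (indep_neq1 hk' hi) ep).
- by apply/Forall_map; apply: Forall_impl iP.
- by move=> g; rewrite /Pj map_map => /cP [].
- by rewrite cPj /p boundary_scal boundary_conv boundary_D.
Qed.

(** The quotient [z^-1 ** z'] lies in the layer and commutes with [w], while [1 - w] acts
    injectively there. *)
Lemma fix_conjugator k z z' w w' : (S k <= d)%nat -> rho k z' = rho k z -> rho k w <> \e ->
  rho (S k) w' = rho (S k) w -> rho (S k) (cj z' w') = rho (S k) (cj z w) ->
  rho (S k) z' = rho (S k) z.
Proof.
move=> hk ez nw ew; rewrite !rho_cj // ew => e; have hk' : (k <= d)%nat by lia.
suff h : rho (S k) (z^-1 ** z') = \e.
  by move: h; rewrite rhoM // rhoV // => h; apply: (@mulgI _ (rho (S k) z)^-1); rewrite h mulVg.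
apply: (ker_comm_trivial hk (w := w)) => //; first by rewrite rhoM // rhoV // ez mulVg.
rewrite rho_cj // rhoM // rhoV //; move: e; rewrite /cj => e.
have e' : rho (S k) z' ** rho (S k) w = rho (S k) z ** rho (S k) w ** (rho (S k) z)^-1 ** rho (S k) z'.
  by rewrite -e !gE.
by rewrite !mulA in e' *; apply: (@mulIg _ (rho (S k) w)); rewrite !gE e' !gE.
Qed.
Lemma fix_commutator k q q' w w' : (S k <= d)%nat -> rho k q' = rho k q -> rho k w <> \e ->
  rho (S k) w' = rho (S k) w -> rho (S k) (cm w' q') = rho (S k) (cm w q) ->
  rho (S k) q' = rho (S k) q.
Proof.
move=> hk eq nw ew; rewrite !rho_cm // ew => e; have hk' : (k <= d)%nat by lia.
apply: (fix_conjugator (w := w^-1) (w' := w'^-1)) => //.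
- by rewrite rhoV // => h; apply: nw; rewrite -[LHS]invK h inv1.
- by rewrite !rhoV // ew.
- rewrite !rho_cj // !rhoV // ew; move: e; rewrite /cm /cj !mulA => /mulgI.
  by [].
Qed.

(** * Endomorphisms fixing the test element *)

Section Pair.
Variables g f : G.
Notation H := (gen G (fun c => c = g \/ c = f)).
Notation t n := (test_elt g f n).
Let Hg : H g. Proof. by apply: gen_in; left. Qed.
Let Hf : H f. Proof. by apply: gen_in; right. Qed.
Let H_test_elt n : H (t n).
Proof. by apply: test_elt_closed => //; [apply: gen_mul | apply: gen_inv]. Qed.
Let H_cj a b : H a -> H b -> H (cj a b).
Proof. by move=> ha hb; do !apply: gen_mul => //; apply: gen_inv. Qed.

Lemma test_elt_ker n : (n <= d)%nat -> rho n (t n) = \e.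
Proof. by move=> hn; apply: der_rho => //; apply: test_elt_derived. Qed.

Section Commutators.
Variable k : nat.
Hypotheses (hk : (S k <= d)%nat) (hgf : rho k (cm g f) = \e).
Let hk' : (k <= d)%nat. Proof. by lia. Qed.
Let good_ker s := rho k s = \e /\
  exists2 J, Forall (fun e => im k (snd e)) J & D k s = conv J (D k (cm g f)).
Let gkM s s' : good_ker s -> good_ker s' -> good_ker (s ** s').
Proof.
move=> [e [J hJ eJ]] [e' [J' hJ' eJ']]; split; first by rewrite rhoM // e e' mulg1.
by exists (J ++ J'); [apply/Forall_app | rewrite D_mul_ker // conv_app eJ eJ'].
Qed.
Let gkV s : good_ker s -> good_ker s^-1.
Proof.
move=> [e [J hJ eJ]]; split; first by rewrite rhoV // e inv1.
exists (neg J); last by rewrite conv_neg DV // e inv1 shift1 eJ.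
by apply/Forall_map; apply: Forall_impl hJ.
Qed.
Let gkJ w s : good_ker s -> good_ker (cj w s).
Proof.
move=> [e [J hJ eJ]]; split; first exact: cj_ker.
exists (lmul (rho k w) J); last by rewrite D_cj // eJ conv_lmul.
by apply/Forall_map; apply: Forall_impl hJ => e' /= ?; apply: im_M => //; apply: im_rho.
Qed.
Let gk1 : good_ker \e.
Proof. by split; [apply: rho1 | exists nil; rewrite // D1]. Qed.
Let cm_left h' : good_ker (cm g h') -> good_ker (cm f h') -> forall h, H h -> good_ker (cm h h').
Proof.
move=> hg hf h; elim=> [c [->|->]||a b _ ha _ hb|a _ ha] //.
- by rewrite /cm !gE.
- have -> : cm (a ** b) h' = cj a (cm b h') ** cm a h' by rewrite /cj /cm !gE.
  by apply: gkM => //; apply: gkJ.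
- have -> : cm a^-1 h' = cj a^-1 (cm a h')^-1 by rewrite /cj /cm !gE.
  by apply: gkJ; apply: gkV.
Qed.
Let cm_sym h h' : good_ker (cm h h') -> good_ker (cm h' h).
Proof. by move=> /gkV; rewrite /cm !gE. Qed.
(** This is where two generators matter: the commutator subgroup of [H] is generated by conjugates
    of [cm g f], so its Fox derivatives lie in a cyclic module. *)
Lemma derived_cyclic s : gen G (fun c => exists a b, H a /\ H b /\ c = cm a b) s ->
  rho k s = \e /\ exists2 J, Forall (fun e => im k (snd e)) J & D k s = conv J (D k (cm g f)).
Proof.
have b0 : good_ker (cm g f).
  split=> //; exists [(1%Z, \e)]; last by rewrite conv_one shift1.
  by do !constructor; apply: im_1.
have b1 h : good_ker (cm h h) by rewrite /cm !gE.
elim=> [c [a [b [ha [hb ->]]]]||a b _ ha _ hb|a _ ha]; [|exact: gk1|exact: gkM|exact: gkV].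
by apply: cm_left => //; apply: cm_sym; apply: cm_left => //; apply: cm_sym.
Qed.
End Commutators.

Section Independent.
Hypotheses (hd : (2 <= d)%nat) (hi : indep 1 g f).
Let hd1 : (1 <= d)%nat. Proof. by lia. Qed.
Let cgf : rho 1 g ** rho 1 f = rho 1 f ** rho 1 g. Proof. exact: rho1_comm. Qed.
Let g1 : rho 1 g <> \e. Proof. exact: indep_neq1 hi. Qed.
Let f1 : rho 1 f <> \e.
Proof. by move=> h; have [_ //] : 0 = 0 /\ 1%Z = 0; apply: hi; rewrite zpow_1 mul1g. Qed.
Let g_f : rho 1 g <> rho 1 f.
Proof.
move=> h; have [//] : 1%Z = 0 /\ -1 = 0; apply: hi.
by rewrite zpow_1 (zpow_opp f 1) zpow_1 rhoM // rhoV // h mulgV.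
Qed.
Let cm_ker1 a b : rho 1 (cm a b) = \e.
Proof. by rewrite rho_cm //; apply: comm_cm1; apply: rho1_comm. Qed.

Notation P := [(1%Z, \e); (2, rho 1 g); (8, rho 1 f)].
Lemma D_test2 a b : D 1 (test2 a b) = conv [(1%Z, \e); (2, rho 1 a); (8, rho 1 b)] (D 1 (cm a b)).
Proof.
have cmk := cm_ker1 a b; have cjk w := cj_ker w hd1 cmk.
have sqD s : rho 1 s = \e -> rho 1 (sq s) = \e /\ D 1 (sq s) = fscal 2 (D 1 s).
  move=> e; rewrite /sq rhoM // e mulg1 D_mul_ker //; split=> //.
  by apply: fn_eq => p; rewrite /fadd /fscal; lia.
have [e1 E1] := sqD _ (cjk a); have [e2 E2] := sqD _ (cjk b).
have [e3 E3] := sqD _ e2; have [e4 E4] := sqD _ e3.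
rewrite /test2 (@D_mul_ker 1 (cm a b)) // (@D_mul_ker 1 (sq (cj a _))) // E4 E3 E2 E1 !D_cj // !conv_cons conv_nil shift1.
by apply: fn_eq => p; rewrite /fadd /fscal /zerof; lia.
Qed.
Let M0 : D 1 (cm g f) <> @zerof _ _.
Proof.
by move=> h; apply: (cm_neq1 hd cgf hi); apply: D_ker.
Qed.
Let imP a b : Forall (fun e => im 1 (snd e)) [(1%Z, \e); (2, rho 1 a); (8, rho 1 b)].
Proof. by do !constructor; [apply: im_1 | apply: im_rho | apply: im_rho]. Qed.

Lemma test_elt_neq1 n : (S n <= d)%nat -> rho (S n) (t n) <> \e.
Proof.
suff : ((S n <= d)%nat -> rho (S n) (t n) <> \e) /\ ((S (S n) <= d)%nat -> rho (S (S n)) (t (S n)) <> \e).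
  by case.
elim: n => [|n [IH IH']].
  split=> // _ /(D_eq1 hd); rewrite D_test2 => e.
  have := no_zero_div hd1 (imP g f) (D_fs _ hd) e M0 (rho 1 f).
  by rewrite /= ind1 ind0 ?(ind0 g_f) //; move=> h; apply: f1.
split=> // hn; rewrite test_eltSS; have hn' : (S (S n) <= d)%nat by lia.
have hn'' : (S n <= d)%nat by lia.
have k1 : rho (S n) (t (S n)) = \e by apply: test_elt_ker.
apply: cm_neq1 => //; first by apply: ker_comm => //; apply: cj_ker.
by apply: cj_indep => //; [apply: IH' | apply: IH].
Qed.

(** The multiplier of the commutator has augmentation 1 + 2 + 8 for [test2] and 1 for the later
    elements; being nonzero, it excludes divisibility. *)
Lemma test_elt_not_divisible n v j : (S (S n) <= d)%nat -> finsupp_at (S n) v ->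
  fscal j (D (S n) (t (S n))) = fsub v (shift (rho (S n) (t n)) v) -> j = 0.
Proof.
move=> hn hv; case: n hn v hv => [|n] hn v hv.
  rewrite [t 1]/(test2 g f) D_test2 => e.
  suff : lin (fun _ => 1%Z) P * j = 0 by rewrite /=; lia.
  apply: (commutator_not_divisible hd cgf hi (imP g f) _ hv e).
  move=> c [<-|[<-|[<-|[]]]]; rewrite ?mul1g ?mulg1 //.
rewrite test_eltSS => e; have hn' : (S (S n) <= d)%nat by lia.
have hn'' : (S n <= d)%nat by lia.
have k1 : rho (S n) (t (S n)) = \e by apply: test_elt_ker.
suff : lin (fun _ => 1%Z) [(1%Z, gone (tower (S (S n))))] * j = 0 by rewrite /=; lia.
apply: (@commutator_not_divisible _ (t (S n)) (cj (t n) (t (S n))) _ _ j hn _ _ _ _ hv).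
- by apply: ker_comm => //; apply: cj_ker.
- by apply: cj_indep => //; apply: test_elt_neq1.
- by do !constructor; apply: im_1.
- by move=> c [<-|[]]; rewrite !mul1g !mulg1.
- by rewrite conv_one shift1.
Qed.

(** The sign left open by [cm_cj_sign] cancels when [Phi] is applied twice. *)
Lemma descent_step Phi n : is_hom G G Phi -> (S (S (S n)) <= d)%nat ->
  rho (S (S (S n))) (Phi (t (S (S n)))) = rho (S (S (S n))) (t (S (S n))) ->
  rho (S (S n)) (Phi (Phi (t (S n)))) = rho (S (S n)) (t (S n)).
Proof.
move=> hP hn; rewrite test_eltSS (hom_cm hP) (hom_cj hP) => e.
have hn1 : (S (S n) <= d)%nat by lia.
have hn2 : (S n <= d)%nat by lia.
have k1 : rho (S n) (t (S n)) = \e by apply: test_elt_ker.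
have k2 : rho (S n) (Phi (t (S n))) = \e.
  by rewrite -(rho1 hn2) -(hom1 hP); apply: hom_rho => //; rewrite k1 rho1.
have [h|h] := cm_cj_sign hn k1 (test_elt_neq1 hn1) (test_elt_neq1 hn2) k2 e.
  have eP : rho (S (S n)) (Phi (t (S n))) = rho (S (S n)) (t (S n)).
    by apply: rho_inj => //; rewrite k1.
  by rewrite (hom_rho hn1 hP eP).
have eP : rho (S (S n)) (Phi (t (S n))) = rho (S (S n)) (t (S n))^-1.
  apply: rho_inj => //; last by rewrite rhoV // k1 k2 inv1.
  rewrite h DV // k1 inv1 shift1; apply: fn_eq => p; rewrite /fscal /fsub /zerof; lia.
by rewrite (hom_rho hn1 hP eP) homV // rhoV // eP rhoV // invK.
Qed.

(** Squaring keeps what is already fixed. The descent ends with [t 1], which is not produced by the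
    recursion and is treated in [base]. *)
Lemma descent phi : is_hom G G phi -> (forall s, H (phi s)) -> phi (t (d - 1)) = t (d - 1) ->
  exists Phi, is_hom G G Phi /\ (forall s, H (Phi s)) /\
    forall n, (1 <= n)%nat -> (S n <= d)%nat -> rho (S n) (Phi (t n)) = rho (S n) (t n).
Proof.
move=> hp Hp e.
suff h j : (S j <= d - 1)%nat -> exists Phi, is_hom G G Phi /\ (forall s, H (Phi s)) /\
    forall n, (d - 1 - j <= n)%nat -> (S n <= d)%nat -> rho (S n) (Phi (t n)) = rho (S n) (t n).
  have [|Phi [hP [HP fP]]] := h (d - 2)%nat; first lia.
  by exists Phi; split=> //; split=> // n h1 h2; apply: fP; lia.
elim: j => [|j IH] hj.
  exists phi; split=> //; split=> // n h1 h2; have -> : n = (d - 1)%nat by lia.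
  by rewrite e.
have [|Phi [hP [HP fP]]] := IH; first lia.
exists (fun s => Phi (Phi s)); split; first exact: comp_hom.
split=> // n h1 h2; case: (Compare_dec.le_lt_dec (d - 1 - j) n) => hn.
  by rewrite (hom_rho h2 hP (fP n hn h2)); apply: fP.
have [m em] : exists m, n = S m by exists (n - 1)%nat; lia.
by subst n; apply: descent_step => //; [lia | apply: fP; lia].
Qed.

(* [D 1 (Phi (cm g f)) = J M] with [(1 + 2X + 8Y) J = 1 + 2g + 8f], where
   [X], [Y] are the images of [g], [f]; the dominant coefficient 8 forces [J = 1]. *)
Lemma base Phi : is_hom G G Phi -> (forall s, H (Phi s)) -> rho 2 (Phi (t 1)) = rho 2 (t 1) ->
  rho 1 (Phi g) = rho 1 g /\ rho 1 (Phi f) = rho 1 f /\ rho 2 (Phi (cm g f)) = rho 2 (cm g f).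
Proof.
move=> hP HP /(rho_proj hd) [e _]; rewrite (hom_test_elt g f 1 hP) [t 1]/(test2 g f) in e.
rewrite [test_elt _ _ 1]/(test2 (Phi g) (Phi f)) !D_test2 in e.
set X := rho 1 (Phi g) in e *; set Y := rho 1 (Phi f) in e *.
have [_ [J iJ eJ]] : rho 1 (cm (Phi g) (Phi f)) = \e /\ exists2 J, Forall (fun e => im 1 (snd e)) J &
    D 1 (cm (Phi g) (Phi f)) = conv J (D 1 (cm g f)).
  by apply: derived_cyclic => //; apply: gen_in; exists (Phi g), (Phi f).
pose P' := [(1%Z, gone (tower 1)); (2, X); (8, Y)].
have iP' : Forall (fun e => im 1 (snd e)) (pmul P' J).
  rewrite /pmul; apply/Forall_flat_map; do !constructor => //; apply/Forall_map;
    apply: Forall_impl iJ => e' /= h; apply: im_M => //; first [exact: im_1 | exact: im_rho].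
have h c : coef (pmul P' J) c = coef P c.
  have : coef (pmul P' J ++ neg P) c = 0; last by rewrite coef_app coef_neg; lia.
  apply: (no_zero_div hd1 _ (D_fs _ hd) _ M0).
    by apply/Forall_app; split=> //; apply/Forall_map; apply: (imP g f).
  rewrite conv_app conv_neg conv_pmul -eJ e; apply: fn_eq => p; rewrite /fadd /fsub /zerof; lia.
pose j := coef J.
have ej z u c : coef (map (fun e' => (z * fst e', u ** snd e')) J) c = z * j (u^-1 ** c).
  rewrite /j; elim: (J) => [|[z' u'] L IH] /=; first lia.
  rewrite IH; have -> : ind (u ** u') c = ind u' (u^-1 ** c); last by rewrite Z.mul_add_distr_l Z.mul_assoc.
  by apply: ind_iff; split=> [<-|->]; rewrite ?gE.
have {}h c : j c + 2 * j (X^-1 ** c) + 8 * j (Y^-1 ** c) =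
    ind \e c + 2 * ind (rho 1 g) c + 8 * ind (rho 1 f) c.
  move: (h c); rewrite /pmul /P'; cbn [flat_map fst snd]; rewrite !coef_app !ej inv1 mul1g.
  cbn [coef fst snd]; lia.
have ind_rng (u c : tower 1) : 0 <= ind u c <= 1%Z by rewrite /ind; case: eqd; lia.
have rhs c : 0 <= ind \e c + 2 * ind (rho 1 g) c + 8 * ind (rho 1 f) c <= 8 /\
    (c <> rho 1 f -> ind \e c + 2 * ind (rho 1 g) c + 8 * ind (rho 1 f) c <= 2).
  rewrite /ind; case: (eqd \e c) => [<-|n1].
    by case: eqd => [h'|_]; [case: (g1 h') | case: eqd => [h'|_]; [case: (f1 h') | lia]].
  case: (eqd (rho 1 g) c) => [<-|n2]; first by case: eqd => [h'|_]; [case: (g_f (eq_sym h')) | lia].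
  by case: eqd => [->|n3]; split=> //; lia.
(* The identity is put in front so that a maximum exists even for empty [J]. *)
have [c0 _ [_ mx]] : exists2 c, In c (\e :: map snd J) & True /\
    forall c', In c' (\e :: map snd J) -> True -> ~ Z.abs (j c) < Z.abs (j c').
  apply: (@maximal_exists _ (fun c c' => Z.abs (j c) < Z.abs (j c')) (fun _ => True)); try lia.
  by exists \e => //; left.
have {}mx c : Z.abs (j c) <= Z.abs (j c0).
  case: (Z.eq_dec (j c) 0) => [->|ne]; first lia.
  suff : ~ Z.abs (j c0) < Z.abs (j c) by lia.
  by apply: mx => //; right; apply: coef_in.
(* At [Y ** c0] the equation bounds [8 |j c0|] by [8 + 3 |j c0|]. *)
have j1 c : Z.abs (j c) <= 1.
  have := h (Y ** c0); rewrite mulKg; have [? _] := rhs (Y ** c0).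
  have := mx c; have := mx (Y ** c0); have := mx (X^-1 ** (Y ** c0)); lia.
(* Away from [rho 1 f] the right side is at most 2, so [8 |j c|] is at most 5. *)
have supp c : j c <> 0 -> Y ** c = rho 1 f.
  move=> hc; apply: NNPP => ne; have [? r2] := rhs (Y ** c); have := r2 ne.
  have := h (Y ** c); rewrite mulKg.
  have := j1 c; have := j1 (Y ** c); have := j1 (X^-1 ** (Y ** c)); lia.
have uniq c c' : j c <> 0 -> j c' <> 0 -> c = c'.
  by move=> hc hc'; apply: (@mulgI _ Y); rewrite (supp _ hc) (supp _ hc').
have g1' := g1; have f1' := f1; have gf' := g_f.
have h1 := h \e; rewrite !mulg1 ind1 (ind0 g1') (ind0 f1') in h1.
have jY : j Y^-1 = 0.
  by apply: NNPP => h'; have := supp _ h'; rewrite mulgV => h''; apply: f1'.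
(* By parity: the equation at the identity is now [j \e + 2 j X^-1 = 1]. *)
have je : j \e <> 0 by lia.
have eY : Y = rho 1 f by rewrite -(supp _ je) mulg1.
have j0 c : c <> \e -> j c = 0.
  by move=> hc; apply: NNPP => hc'; apply: hc; apply: uniq.
have X1 : X^-1 <> \e by move=> hX; move: h1; rewrite hX jY; have := j1 \e; lia.
have je1 : j \e = 1%Z by move: h1; rewrite (j0 _ X1) jY; lia.
have h2 : j (rho 1 g) + 2 * j (X^-1 ** rho 1 g) + 8 * j (Y^-1 ** rho 1 g) = 2.
  by rewrite h ind1 (ind0 (fun h' => g1' (eq_sym h'))) (ind0 (fun h' => gf' (eq_sym h'))).
have eX : X^-1 ** rho 1 g = \e.
  apply: NNPP => hX; move: h2; rewrite (j0 _ g1') (j0 _ hX) j0; last lia.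
  by rewrite eY => h'; apply: gf'; rewrite -(mulKVg (rho 1 f) (rho 1 g)) h' mulg1.
split; first by rewrite -(mulKVg X (rho 1 g)) eX mulg1.
split=> //; rewrite (hom_cm hP); apply: rho_inj => //; last by rewrite !cm_ker1.
rewrite eJ -[RHS]shift1 -conv_one; apply: conv_ext => c /=.
rewrite -/(j c) /ind; case: eqd => [<-|ne]; first by rewrite je1.
by rewrite j0 //; move=> hc; apply: ne.
Qed.

(** * From the test elements back to the generators *)

Section Ascent.
Variable Phi : G -> G.
Hypotheses (hP : is_hom G G Phi) (HP : forall s, H (Phi s)).
Hypothesis fP : forall n, (1 <= n)%nat -> (S n <= d)%nat -> rho (S n) (Phi (t n)) = rho (S n) (t n).

Lemma rho_eq_on_H k (A B : G -> G) : (k <= d)%nat -> is_hom G G A -> is_hom G G B ->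
  rho k (A g) = rho k (B g) -> rho k (A f) = rho k (B f) -> forall h, H h -> rho k (A h) = rho k (B h).
Proof.
move=> hk hA hB eg ef; apply: (hom_gen_eq (p := fun s => rho k (A s)) (q := fun s => rho k (B s))).
- exact: comp_hom hA (rho_hom hk).
- exact: comp_hom hB (rho_hom hk).
- by move=> a [->|->].
Qed.

Section Fox.
Variables (k : nat) (A : G -> G).
Hypotheses (hk : (S k <= d)%nat) (k1 : (1 <= k)%nat) (hA : is_hom G G A).
Hypothesis fA : forall h, H h -> rho k (A h) = rho k h.
Let hk' : (k <= d)%nat. Proof. by lia. Qed.
Let env := pair_env g f.
Let H_env w : H (weval G env w).
Proof.
elim: w => [n||u hu v hv|u hu] /=; [|exact: gen_one|exact: gen_mul|exact: gen_inv].
by case: n => [//|[//|n]]; apply: gen_one.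
Qed.
Let defect s := fsub (D k (A s)) (D k s).
(** Since [A] is the identity on [H] at level [k], [defect] is a derivation on words in [g] and [f],
    and only the derivative by [f] survives. *)
Lemma fox_rule w : defect g = @zerof _ _ ->
  defect (weval G env w) = conv (map (fun e => (fst e, rho k (weval G env (snd e)))) (fox w)) (defect f).
Proof.
move=> eg; elim: w => [n||u hu v hv|u hu] /=.
- case: n => [|[|n]] //=; first by rewrite conv_one rho1 // shift1.
  by rewrite /defect hom1 // !D1.
- by rewrite /defect hom1 // !D1.
- have -> : map (fun e => (fst e, rho k (weval G env (snd e))))
      (fox u ++ map (fun e => (fst e, wmul u (snd e))) (fox v)) =
    map (fun e => (fst e, rho k (weval G env (snd e)))) (fox u) ++
    lmul (rho k (weval G env u)) (map (fun e => (fst e, rho k (weval G env (snd e)))) (fox v)).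
    by rewrite map_app /lmul !map_map; congr (_ ++ _); apply: map_ext => e /=; rewrite rhoM.
  rewrite conv_app conv_lmul -hu -hv /defect hA !DM // fA // shift_sub.
  by apply: fn_eq => p; rewrite /fadd /fsub; lia.
- have -> : map (fun e => (fst e, rho k (weval G env (snd e))))
      (map (fun e => (- fst e, wmul (winv u) (snd e))) (fox u)) =
    neg (lmul (rho k (weval G env u))^-1 (map (fun e => (fst e, rho k (weval G env (snd e)))) (fox u))).
    by rewrite /neg /lmul !map_map; apply: map_ext => e /=; rewrite rhoM // rhoV.
  rewrite conv_neg conv_lmul -hu /defect homV // !DV // fA // shift_sub.
  by apply: fn_eq => p; rewrite /fsub /zerof; lia.
Qed.

Let expoE w : rho 1 (weval G env w) = rho 1 (zpow g (fst (expo w)) ** zpow f (snd (expo w))).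
Proof.
have cz i j : zpow (rho 1 f) j ** zpow (rho 1 g) i = zpow (rho 1 g) i ** zpow (rho 1 f) j.
  by rewrite -!rho_zpow //; apply: rho1_comm.
rewrite rhoM // !rho_zpow //; elim: w => [n||u hu v hv|u hu]; cbn [weval expo fst snd].
- case: n => [|[|n]]; last by rewrite -[RHS]/(gone (tower 1) ** \e) mulg1; apply: rho1.
    by rewrite -[LHS]mulg1 -{1}(zpow_1 (rho 1 g)).
  by rewrite -[LHS]mul1g -{1}(zpow_1 (rho 1 f)).
- by rewrite -[RHS]/(gone (tower 1) ** \e) mulg1 rho1.
- rewrite rhoM // hu hv !zpow_add !mulA; congr (_ ** _).
  by rewrite -!mulA cz.
- by rewrite rhoV // hu !zpow_opp invM -!zpow_opp cz.
Qed.

(** The Fox derivative of [test2] kills [defect f] without being zero: its coefficients over the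
    coset of [zpow g 2] modulo level 1 add up to 2. Independence is what lets the exponents be read
    off from that coset. *)
Lemma fox_fix : rho (S k) (A g) = rho (S k) g -> rho (S k) (A (test2 g f)) = rho (S k) (test2 g f) ->
  rho (S k) (A f) = rho (S k) f.
Proof.
have dE s : rho (S k) (A s) = rho (S k) s -> defect s = @zerof _ _.
  by move=> /(rho_proj hk) [e _]; apply: fn_eq => p; rewrite /defect e /fsub /zerof; lia.
move=> /dE eg /dE; rewrite -(weval_wtest2 g f) fox_rule // => e.
suff e0 : defect f = @zerof _ _.
  by apply: rho_inj => //; [apply: fn_eq => p; have := eq_fn e0 p; rewrite /defect /fsub /zerof; lia | exact: fA].
apply: NNPP => ne; pose L := map (fun e => (fst e, rho k (weval G env (snd e)))) (fox wtest2).
have iL : Forall (fun e => im k (snd e)) L.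
  by apply/Forall_map; apply/Forall_forall => e' _; apply: im_rho.
have fold_sum : finsupp_at k (defect f) by apply: finsupp_sub; apply: D_fs.
have L0 := no_zero_div hk' iL fold_sum e ne.
pose Q c := exists s, c = rho k s /\ rho 1 s = rho 1 (zpow g 2).
pose F c : Z := if excluded_middle_informative (Q c) then 1%Z else 0.
have : lin F L = 0 by apply: lin_zero => c; left.
rewrite /L (lin_map (fun w => rho k (weval G env w))).
suff -> : lin (fun w => F (rho k (weval G env w))) (fox wtest2) = 2 by [].
rewrite -[RHS]fox_wtest2; elim: (fox wtest2) => [//|[z w] M IH] /=; rewrite IH; congr (_ + _).
have QE : Q (rho k (weval G env w)) <-> fst (expo w) = 2 /\ snd (expo w) = 0.
  split=> [[s [es e2]]|[e1 e2]].
    have : rho 1 (zpow g (fst (expo w) - 2) ** zpow f (snd (expo w))) = \e; last first.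
      by move=> /hi [? ?]; lia.
    have ew : rho 1 (weval G env w) = rho 1 (zpow g 2) by rewrite -e2; apply: rho_le hk' es.
    have -> : fst (expo w) - 2 = - (2) + fst (expo w) by lia.
    by rewrite zpow_add mulA rhoM // -expoE ew -rhoM // -zpow_add /= rho1.
  by exists (weval G env w); split=> //; rewrite expoE e1 e2 /= mulg1.
rewrite /F; case: excluded_middle_informative => hQ.
  by have [-> ->] := proj1 QE hQ; rewrite /= Z.mul_1_r.
case: (Z.eqb_spec (fst (expo w)) 2) => [e1'|_] /=; last by rewrite Z.mul_0_r.
case: (Z.eqb_spec (snd (expo w)) 0) => [e2'|_] /=; last by rewrite Z.mul_0_r.
by case: hQ; apply/QE.
Qed.
End Fox.

(** The recursion is undone from its end: once [A] fixes a commutator and its first entry it fixes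
    the conjugate in the second, and from that the conjugator [t n]. *)
Lemma test_elt_fix_descend k n A : (S k <= d)%nat -> (S n <= k)%nat -> is_hom G G A ->
  (forall h, H h -> rho k (A h) = rho k h) ->
  rho (S k) (A (t n)) = rho (S k) (t n) -> rho (S k) (A (t (S n))) = rho (S k) (t (S n)) ->
  rho (S k) (A g) = rho (S k) g /\ rho (S k) (A (test2 g f)) = rho (S k) (test2 g f).
Proof.
move=> hk hn hA fA; have hk' : (k <= d)%nat by lia.
elim: n hn => [|n IH] hn en en1; first by split.
have nw : rho k (t (S n)) <> \e.
  move=> h; apply: (test_elt_neq1 (n := S n)); first lia.
  by apply: (rho_le1 _ hk' h); lia.
have Hc : H (cj (t n) (t (S n))) by exact: H_cj (H_test_elt _) (H_test_elt _).
apply: IH => //; first lia.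
apply: (fix_conjugator (w := t (S n)) (w' := A (t (S n))) hk) => //; first exact: fA.
rewrite -(hom_cj hA); apply: (fix_commutator (w := t (S n)) (w' := A (t (S n))) hk) => //; first exact: fA.
by rewrite -(hom_cm hA).
Qed.

(** After removal of the new conjugator [n], the map [A] fixes [a] and [cj w a], so
    [c = w^-1 ** A w] commutes with [a] and is dependent on it one level earlier. But there its
    derivative is a multiple of [1 - w], which no nonzero multiple of [D (S m) a] is. Hence [c] is
    trivial and [A] fixes [w] and [a], from which [g] and [f] are recovered. *)
Lemma ascent m : (S (S m) <= d)%nat ->
  exists e, rho (S m) e = \e /\ forall h, H h -> rho (S (S m)) (Phi h) = rho (S (S m)) (cj e h).
Proof.
elim: m => [|m IH] hm.
  have [eg [ef ec]] := base hP HP (fP (PeanoNat.Nat.le_refl 1) hd).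
  have [n [en [ng nf]]] := same_cm_conj hd cgf hi eg ef (eq_trans (f_equal _ (eq_sym (hom_cm hP g f))) ec).
  by exists n; split=> //; apply: rho_eq_on_H => //; apply: cj_hom.
have hm1 : (S (S m) <= d)%nat by lia.
have hm2 : (S m <= d)%nat by lia.
have [e [ee eP]] := IH hm1.
pose a := t (S m); pose w := t m.
have ka : rho (S m) a = \e by apply: test_elt_ker.
have na : rho (S (S m)) a <> \e by apply: test_elt_neq1.
have nw : rho (S m) w <> \e by apply: test_elt_neq1.
have kb : rho (S m) (cj w a) = \e by apply: cj_ker.
have Hw : H w by exact: H_test_elt.
have Ha : H a by exact: H_test_elt.
have Hb : H (cj w a) by exact: H_cj (H_test_elt _) (H_test_elt _).
have fixk s : H s -> rho (S m) s = \e -> rho (S (S m)) (Phi s) = rho (S (S m)) s.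
  move=> Hs es; rewrite eP // rho_cj // /cj ker_comm // !gE.
  by [].
have cab : rho (S (S m)) a ** rho (S (S m)) (cj w a) = rho (S (S m)) (cj w a) ** rho (S (S m)) a.
  exact: ker_comm.
have iab : indep (S (S m)) a (cj w a) by apply: cj_indep.
have ecm : rho (S (S (S m))) (cm (Phi a) (Phi (cj w a))) = rho (S (S (S m))) (cm a (cj w a)).
  by rewrite -(hom_cm hP); apply: (fP (n := S (S m))) => //; lia.
have [n [en [na' nb']]] := same_cm_conj hm cab iab (fixk _ (H_test_elt _) ka) (fixk _ Hb kb) ecm.
pose A s := cj n^-1 (Phi s).
have hA : is_hom G G A by exact: comp_hom hP (cj_hom _).
have A2 h : rho (S (S m)) (A h) = rho (S (S m)) (Phi h).
  by rewrite /A rho_cj // rhoV // en /cj !gE.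
have Aa : rho (S (S (S m))) (A a) = rho (S (S (S m))) a.
  by rewrite /A rho_cj // na' -rho_cj // /cj !gE.
have Ab : rho (S (S (S m))) (A (cj w a)) = rho (S (S (S m))) (cj w a).
  by rewrite /A rho_cj // nb' -rho_cj // /cj !gE.
pose c := w^-1 ** A w.
have c1 : rho (S m) c = \e.
  rewrite /c rhoM // rhoV // (rho_le (s := A w) (t := cj e w) (l := S (S m))) //; try lia.
    by rewrite A2 eP //.
  by rewrite rho_cj // ee /cj !gE.
have cca : rho (S (S (S m))) (cj c a) = rho (S (S (S m))) a.
  have -> : cj c a = cj w^-1 (cj (A w) a) by rewrite /cj /c !gE.
  by rewrite rho_cj // (rho_cj (A w)) // -Aa -rho_cj // -(hom_cj hA) Ab -rho_cj // /cj !gE Aa.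
have cmca : rho (S (S (S m))) (cm c a) = \e.
  have -> : cm c a = cj c a ** a^-1 by rewrite /cj /cm !gE.
  by rewrite rhoM // cca rhoV // mulgV.
pose E := D (S m) e.
have cE : rho (S (S m)) c = rho (S (S m)) (cj w^-1 e ** e^-1).
  by rewrite /c rhoM // A2 eP // -rhoM // /cj !gE.
have Dc : D (S m) c = fsub (shift (rho (S m) w)^-1 E) E.
  have [-> _] := rho_proj hm1 cE; rewrite D_mul_ker //; first exact: cj_ker.
  rewrite D_cj // rhoV // DV // ee inv1 shift1 -/E.
  by apply: fn_eq => p; rewrite /fadd /fsub /zerof; lia.
have c2 : rho (S (S m)) c = \e.
  apply: NNPP => nc.
  have cca' : rho (S (S m)) c ** rho (S (S m)) a = rho (S (S m)) a ** rho (S (S m)) c by apply: ker_comm.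
  apply: (cm_neq1 hm cca' _ cmca) => i j; rewrite rhoM // => eij.
  have zk s z : rho (S m) s = \e -> rho (S m) (zpow s z) = \e by move=> es; rewrite rho_zpow // es zpow_e.
  have := D_eq1 hm1 (eq_trans (rhoM _ _ hm1) eij); rewrite D_mul_ker ?zk // !D_zpow // => eD.
  have j0 : j = 0.
    apply: (test_elt_not_divisible (v := fscal (- i) (shift (rho (S m) w)^-1 E)) hm1).
      by rewrite -rhoV //; apply: finsupp_scal; apply: finsupp_shiftk => //; apply: D_fs.
    have -> : shift (rho (S m) w) (fscal (- i) (shift (rho (S m) w)^-1 E)) = fscal (- i) E.
      by rewrite -[in RHS](shiftK (rho (S m) w)^-1 E) invK.
    by apply: fn_eq => p; have := eq_fn eD p; rewrite Dc -/a /fadd /fscal /fsub /zerof; lia.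
  split=> //; apply: NNPP => i0; apply: nc; apply: D_ker => //.
  by apply: fn_eq => p; have := eq_fn eD p; rewrite j0 /fadd /fscal /zerof; nia.
have c3 : rho (S (S (S m))) c = \e.
  apply: (ker_comm_trivial hm c2 na); rewrite rho_cj //.
  by move: cmca; rewrite rho_cm // /cj => /cm1_comm <-; rewrite !gE.
have Aw : rho (S (S (S m))) (A w) = rho (S (S (S m))) w.
  by rewrite -[RHS]mulg1 -c3 /c -rhoM // mulKVg.
(* Triviality of [c] reads [(w^-1 - 1) E = 0], so the old conjugator [e] vanishes one level deeper
   and [A] is the identity on [H] there. *)
have E0 : E = @zerof _ _.
  apply: (fixed0 (s := w^-1) hm2 _ (D_fs _ hm1)).
    by rewrite rhoV // => h; apply: nw; rewrite -(invK (rho (S m) w)) h inv1.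
  have := D_eq1 hm1 c2; rewrite Dc rhoV // -/E => h.
  by apply: fn_eq => p; have := eq_fn h p; rewrite /fsub /zerof; lia.
have e2 : rho (S (S m)) e = \e by apply: D_ker.
have A2' h : H h -> rho (S (S m)) (A h) = rho (S (S m)) h.
  by move=> Hh; rewrite A2 eP // rho_cj // e2 /cj !gE.
have [Ag At] := test_elt_fix_descend hm (PeanoNat.Nat.le_succ_diag_r (S m)) hA A2' Aw Aa.
have Af : rho (S (S (S m))) (A f) = rho (S (S (S m))) f.
  by apply: fox_fix => //; lia.
exists n; split=> //; apply: rho_eq_on_H => //; try exact: cj_hom.
  by rewrite rho_cj // -Ag -rho_cj // /A /cj !gE.
by rewrite rho_cj // -Af -rho_cj // /A /cj !gE.
Qed.
End Ascent.

Lemma rho_inj_top k a b : k = d -> rho k a = rho k b -> a = b.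
Proof. by move=> ->; apply: rho_d_inj. Qed.

Lemma retract_of_independent phi : is_hom G G phi -> (forall s, H (phi s)) ->
  phi (t (d - 1)) = t (d - 1) -> retract G H.
Proof.
move=> hp Hp fp; have [Phi [hP [HP fP]]] := descent hp Hp fp.
have [m em] : exists m, S (S m) = d by exists (d - 2)%nat; lia.
have hm : (S (S m) <= d)%nat by lia.
have hm1 : (S m <= d)%nat by lia.
have [e [e1 eP]] := ascent hP HP fP hm.
have {}eP h : H h -> Phi h = cj e h by move=> /eP; apply: rho_inj_top.
have ee : Phi e ** e = e ** Phi e.
  apply: (rho_inj_top em); rewrite !rhoM //; apply: ker_comm => //.
  by rewrite -(rho1 hm1) -(hom1 hP); apply: hom_rho => //; rewrite e1 rho1.
(* The conjugator [e] may lie outside [H]. Its image [Phi e] lies in [H], and [Phi] fixes it because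
   it commutes with [e]. *)
exists (fun s => cj (Phi e)^-1 (Phi s)); split; first exact: comp_hom hP (cj_hom _).
have Hpsi s : H (cj (Phi e)^-1 (Phi s)) by apply: H_cj => //; apply: gen_inv.
split=> // h Hh.
have ePe : Phi (Phi e) = Phi e by rewrite eP // /cj -ee !gE.
(* On [H] the map [Phi] is conjugation by [e], hence injective, so it suffices to compare images
   under [Phi]. *)
have E : cj e (cj (Phi e)^-1 (Phi h)) = cj e h.
  rewrite -(eP _ (Hpsi h)) -(eP h Hh) {1}(eP h Hh).
  by rewrite /cj !(hP, homV hP) ePe !gE.
by move: E; rewrite {1 3}/cj => /mulIg /mulgI.
Qed.
End Independent.

(** * Verbally closed subgroups *)

Lemma word_of s : exists w, weval G x w = s /\
  forall asg asg' : nat -> G, (forall i, (i < r)%nat -> asg i = asg' i) -> weval G asg w = weval G asg' w.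
Proof.
elim/gen_ind_x: s => [i hi||a b [u [eu hu]] [v [ev' hv]]|a [u [eu hu]]].
- by exists (wvar i); split=> // asg asg'; apply.
- by exists wone.
- by exists (wmul u v); split=> [|asg asg' h] /=; rewrite ?eu ?ev' // (hu _ _ h) (hv _ _ h).
- by exists (winv u); split=> [|asg asg' h] /=; rewrite ?eu // (hu _ _ h).
Qed.

(** The unknowns are the free generators, so a solution in [H] is an endomorphism with values in
    [H]. For [n = 0] the element is [a] itself. *)
Lemma solve_test_elt a b n : verbally_closed G H -> H (test_elt a b n) ->
  exists phi, is_hom G G phi /\ (forall s, H (phi s)) /\ phi (test_elt a b n) = test_elt a b n.
Proof.
move=> vc hab; have [wa [ea ha]] := word_of a; have [wb [eb hb]] := word_of b.
have [w hw] := @expressible_test_elt G (fun asg => weval G asg wa) (fun asg => weval G asg wb) n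
  (ex_intro _ wa (fun _ => eq_refl)) (ex_intro _ wb (fun _ => eq_refl)).
have [|asg [Hasg easg]] := proj1 (vc w _ hab); first by exists x; rewrite hw ea eb.
have [sol _] := hfree; have [phi [hp px]] := lift asg sol (PeanoNat.Nat.le_refl d).
have pw u c : weval G x u = c -> (forall asg asg' : nat -> G, (forall i, (i < r)%nat -> asg i = asg' i) ->
    weval G asg u = weval G asg' u) -> phi c = weval G asg u.
  by move=> <- h; rewrite (hom_weval hp); apply: h.
exists phi; split=> //; split; last first.
  by rewrite (hom_test_elt a b n hp) (pw _ _ ea ha) (pw _ _ eb hb) -hw.
apply: gen_ind_x => [i hi||s s' hs hs'|s hs].
- by rewrite px.
- by rewrite hom1 //; apply: gen_one.
- by rewrite hp; apply: gen_mul.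
- by rewrite homV //; apply: gen_inv.
Qed.

(** * Generators dependent modulo the first derived subgroup *)

Section Dependent.
Hypotheses (hd1 : (1 <= d)%nat) (vc : verbally_closed G H).
Notation H' := (gen G (fun c => exists a b, H a /\ H b /\ c = cm a b)).

Lemma derived_of_verbally_closed s : H s -> rho 1 s = \e -> H' s.
Proof.
move=> Hs /(ker_rho hd1) ds.
suff [w [ew hw]] : exists w, weval G x w = s /\
    forall asg : nat -> G, (forall i, H (asg i)) -> H' (weval G asg w).
  have [|asg [Hasg <-]] := proj1 (vc w Hs); [by exists x | exact: hw].
have Hw asg u : (forall i, H (asg i)) -> H (weval G asg u).
  by move=> h; elim: u => [i||u hu v hv|u hu] /=; [|apply: gen_one|apply: gen_mul|apply: gen_inv].
elim: ds => {s Hs} [s [a [b [_ [_ ->]]]]||a b _ [u [<- hu]] _ [v [<- hv]]|a _ [u [<- hu]]].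
- have [u [eu _]] := word_of a; have [v [ev' _]] := word_of b.
  exists (wcm (winv u) (winv v)); split.
    by rewrite /= eu ev' /commutator !gE.
  move=> asg h; apply: gen_in; exists (weval G asg u)^-1, (weval G asg v)^-1.
  by do !split; apply: gen_inv; apply: Hw.
- by exists wone; split=> // *; apply: gen_one.
- by exists (wmul u v); split=> // asg h; apply: gen_mul; auto.
- by exists (winv u); split=> // asg h; apply: gen_inv; auto.
Qed.

(** [R] is the geometric sum [1 + b + ... + b^(j-1)], continued to negative [j]. *)
Lemma cm_zpow k a b j : (S k <= d)%nat -> rho k (cm a b) = \e ->
  rho k (cm a (zpow b j)) = \e /\ exists R, Forall (fun e => im k (snd e)) R /\
    D k (cm a (zpow b j)) = conv R (D k (cm a b)) /\ lin (fun _ => 1%Z) R = j.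
Proof.
move=> hk e; have hk' : (k <= d)%nat by lia.
have iml s L : Forall (fun e => im k (snd e)) L -> Forall (fun e => im k (snd e)) (lmul (rho k s) L).
  by move=> hL; apply/Forall_map; apply: Forall_impl hL => e' /= ?; apply: im_M => //; apply: im_rho.
elim/Z.peano_ind: j => [|j [e1 [R [iR [eR lR]]]]|j [e1 [R [iR [eR lR]]]]].
- have -> : cm a (zpow b 0) = \e by rewrite /cm /= !gE.
  by split; [apply: rho1 | exists nil; do !split => //; rewrite D1].
- have -> : cm a (zpow b (Z.succ j)) = cm a b ** cj b (cm a (zpow b j)).
    by rewrite zpow_succ /cm /cj !gE.
  have e2 := cj_ker b hk' e1; split; first by rewrite rhoM // e e2 mulg1.
  exists ((1%Z, \e) :: lmul (rho k b) R); split.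
    by constructor; [apply: im_1 | apply: iml].
  rewrite /= lin_lmul lR D_mul_ker // D_cj // conv_cons conv_lmul -eR shift1; split; last by lia.
  by apply: fn_eq => p; rewrite /fadd /fscal; lia.
- have -> : cm a (zpow b (Z.pred j)) = cj b^-1 (cm a b)^-1 ** cj b^-1 (cm a (zpow b j)).
    by rewrite zpow_pred /cm /cj !gE.
  have e2 := cj_ker b^-1 hk' e1.
  have e0 : rho k (cm a b)^-1 = \e by rewrite rhoV // e inv1.
  have e3 := cj_ker b^-1 hk' e0.
  split; first by rewrite rhoM // e3 e2 mulg1.
  exists ((-1, rho k b^-1) :: lmul (rho k b^-1) R); split.
    by constructor; [apply: im_rho | apply: iml].
  rewrite /= lin_lmul lR D_mul_ker // !D_cj // DV // e inv1 shift1 conv_cons conv_lmul -eR; split; last by lia.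
  by apply: fn_eq => p; rewrite /fadd /fscal /fsub /zerof /shift; lia.
Qed.

(* With [s = a^i b^j] and [D s = Q M], [M = D (cm a b)], computing [D (cm a s)] in two ways
   gives an annihilator of [M] of augmentation [- j]. *)
Lemma dependent_step k a b i j Q : (S k <= d)%nat -> j <> 0 -> rho k (cm a b) = \e ->
  rho k (zpow a i ** zpow b j) = \e -> Forall (fun e => im k (snd e)) Q ->
  D k (zpow a i ** zpow b j) = conv Q (D k (cm a b)) -> rho (S k) (cm a b) = \e.
Proof.
move=> hk hj e; set s := _ ** _ => es iQ eQ; have hk' : (k <= d)%nat by lia.
have [e1 [R [iR [eR lR]]]] := cm_zpow j hk e.
have e2 : cm a s = cj a s ** s^-1 by rewrite /cm /cj.
have e3 : cm a s = cj (zpow a i) (cm a (zpow b j)).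
  have c : a ** zpow a i = zpow a i ** a by rewrite zpow_comm.
  by rewrite /cm /s /cj !invM !mulA -(mulA a (zpow a i)) c !mulA.
apply: D_ker => //; apply: NNPP => ne.
pose L := lmul (rho k a) Q ++ neg Q ++ neg (lmul (rho k (zpow a i)) R).
have iml c M : Forall (fun e => im k (snd e)) M -> Forall (fun e => im k (snd e)) (lmul (rho k c) M).
  by move=> hL; apply/Forall_map; apply: Forall_impl hL => e' /= ?; apply: im_M => //; apply: im_rho.
have imn M : Forall (fun e => im k (snd e)) M -> Forall (fun e => im k (snd e)) (neg M).
  by move=> hL; apply/Forall_map; apply: Forall_impl hL.
have iL : Forall (fun e => im k (snd e)) L.
  by apply/Forall_app; split; [apply: iml|apply/Forall_app; split; apply: imn => //; apply: iml].
have L0 : conv L (D k (cm a b)) = @zerof _ _.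
  have h1 : D k (cm a s) = fsub (shift (rho k a) (D k s)) (D k s).
    rewrite e2 D_mul_ker //; first exact: cj_ker.
    by rewrite D_cj // DV // es inv1 shift1; apply: fn_eq => p; rewrite /fadd /fsub /zerof; lia.
  have h2 : D k (cm a s) = shift (rho k (zpow a i)) (conv R (D k (cm a b))) by rewrite e3 D_cj // eR.
  rewrite h1 in h2; rewrite /L !conv_app !conv_neg !conv_lmul -eQ -h2.
  by apply: fn_eq => p; rewrite /fadd /fsub /zerof; lia.
have L1 := no_zero_div hk' iL (D_fs _ hk) L0 ne.
have : lin (fun _ => 1%Z) L = 0 by apply: lin_zero => c; left.
by rewrite /L !lin_app !lin_neg !lin_lmul lR; lia.
Qed.

Variables i j : Z.
Hypotheses (hij : i <> 0 \/ j <> 0) (hs : rho 1 (zpow g i ** zpow f j) = \e).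
Let s := zpow g i ** zpow f j.
Let H_zpow a z : H a -> H (zpow a z).
Proof.
move=> ha; elim/Z.peano_ind: z => [|z IH|z IH]; first exact: gen_one.
  by rewrite zpow_succ; apply: gen_mul.
by rewrite zpow_pred; apply: gen_mul => //; apply: gen_inv.
Qed.
Let Hs : H s. Proof. by apply: gen_mul; apply: H_zpow. Qed.

Lemma dependent_commute : g ** f = f ** g.
Proof.
apply: cm1_comm; apply: rho_d_inj; rewrite rho1 //.
suff h k : (1 <= k)%nat -> (k <= d)%nat -> rho k (cm g f) = \e by apply: h.
elim: k => [|[_ _ hk|k IH _ hk]]; first lia.
  by rewrite rho_cm //; apply: comm_cm1; apply: rho1_comm.
have hk' : (S k <= d)%nat by lia.
have k1 : (1 <= S k)%nat by lia.
move: (IH k1 hk') => {}IH.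
have [es [Q iQ eQ]] := derived_cyclic hk IH (derived_of_verbally_closed Hs hs).
case: (Z.eq_dec j 0) => [j0|nj]; last exact: dependent_step hk nj IH es iQ eQ.
(* For [j = 0] the exponent [i] is nonzero and [g], [f] exchange roles; [Q] changes sign because the
   commutator is inverted. *)
have cfg : cm f g = (cm g f)^-1 by rewrite /cm !gE.
have eqs : zpow f 0 ** zpow g i = s by rewrite /s j0 /= !gE.
suff : rho (S (S k)) (cm f g) = \e.
  by rewrite cfg rhoV // => h; rewrite -(invK (rho _ (cm g f))) h inv1.
apply: (@dependent_step (S k) f g 0 i (neg Q)) => //.
- by case: hij.
- by rewrite cfg rhoV // IH inv1.
- by rewrite eqs.
- by apply/Forall_map; apply: Forall_impl iQ.
- rewrite eqs eQ cfg DV // IH inv1 shift1 conv_neg conv_sub conv_zerof.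
  by apply: fn_eq => p; rewrite /fsub /zerof; lia.
Qed.

(** [H] is abelian and torsion-free with [g^i f^j = 1]. For nonzero [j], a map that fixes [g] fixes
    [f^j] and therefore [f]; for [j = 0] the generator [g] is trivial. *)
Lemma retract_of_dependent : retract G H.
Proof.
have comm1 c : c ** g = g ** c -> c ** f = f ** c -> forall h, H h -> c ** h = h ** c.
  move=> cg cf h; elim=> [a [->|->]||a b _ ha _ hb|a _ ha] //; first by rewrite !gE.
    by rewrite (comm_mul (a := a) (b := b) (c := c)).
  by rewrite -(comm_inv (a := a)).
have comm h h' : H h -> H h' -> h ** h' = h' ** h.
  move=> Hh Hh'; apply: (comm1) => //; symmetry; apply: (comm1) => //; try exact: dependent_commute.
  by rewrite dependent_commute.
have s1 : s = \e.
  elim: (derived_of_verbally_closed Hs hs) => [c [a [b [ha [hb ->]]]]||a b _ -> _ ->|a _ ->];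
    by [apply: comm_cm1; apply: comm | rewrite ?mul1g ?inv1].
have tf (a : G) z : z <> 0 -> zpow a z = \e -> a = \e.
  move=> hz e; apply: rho_d_inj; rewrite rho1 //; apply: (rho_tf _ hz) => //.
  by rewrite e rho1.
have fix_both phi : is_hom G G phi -> (forall s, H (phi s)) -> phi g = g -> phi f = f -> retract G H.
  move=> hp Hp pg pf; exists phi; split=> //; split=> //.
  by apply: (hom_gen_eq (q := fun s => s) hp) => // a [->|->].
case: (Z.eq_dec j 0) => [j0|nj].
  have g1 : g = \e.
    by apply: (tf g i); [case: hij | move: s1; rewrite /s j0 /= mulg1].
  have [phi [hp [Hp pf]]] := solve_test_elt (a := f) (b := f) (n := 0) vc Hf.
  by apply: (fix_both phi) => //; rewrite g1 hom1.
have [phi [hp [Hp pg]]] := solve_test_elt (a := g) (b := g) (n := 0) vc Hg.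
apply: (fix_both phi) => //; apply: mulV_eq1; apply: (tf _ j) => //.
rewrite zpow_mulg; first by apply: comm => //; apply: gen_inv.
have : phi s = s by rewrite s1 hom1.
rewrite /s hp !(hom_zpow hp) [phi g]pg => /mulgI ->.
by rewrite zpow_inv mulgV.
Qed.
End Dependent.
End Pair.
End FreeSolvable.

(* The equivalence of the three conditions *)
Close Scope Z_scope.

Lemma retract_alg_closed (G : Group) (H : G -> Prop) : retract G H -> alg_closed G H.
Proof.
move=> [phi [hp [Hp fp]]] sys csys [asg sol]; exists (fun n => phi (asg n)); split=> //.
have coef_phi t : consts_in H t -> phi (eval G asg t) = eval G (fun n => phi (asg n)) t.
  elim: t => [n|a||u hu v hv|u hu] //=; [exact: fp|by rewrite hom1|move=> [cu cv]|move=> cu].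
    by rewrite hp hu // hv.
  by rewrite homV // hu.
apply/Forall_forall => t ht.
rewrite -coef_phi; first by apply: (proj1 (Forall_forall _ _) csys).
by rewrite (proj1 (Forall_forall _ _) sol t ht) hom1.
Qed.

Lemma alg_closed_verbally_closed (G : Group) (H : G -> Prop) : alg_closed G H -> verbally_closed G H.
Proof.
move=> ac w h Hh; split=> [[asg e]|[asg [_ e]]]; last by exists asg.
pose tw := fix tw (w : word) : term G :=
  match w with
  | wvar n => tvar n | wone => tone | wmul u v => tmul (tw u) (tw v) | winv u => tinv (tw u)
  end.
have tw_eval asg' u : eval G asg' (tw u) = weval G asg' u.
  by elim: u => [n||u hu v hv|u hu] //=; rewrite ?hu ?hv.
have tw_consts u : consts_in H (tw u) by elim: u => //=.
have [||asg' [Hasg' sol]] := ac [tmul (tw w) (tinv (tconst h))].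
    by constructor.
  by exists asg; constructor=> //=; rewrite tw_eval e mulgV.
exists asg'; split=> //; apply: mulV_eq1.
by inversion sol; rewrite -tw_eval.
Qed.

Theorem theorem5p4 :
  forall (r d : nat), 2 <= r -> 2 <= d ->
  forall (G : Group) (x : nat -> G), free_solvable r d G x ->
  forall g f : G,
    let H := gen G (fun c => c = g \/ c = f) in
    (retract G H <-> alg_closed G H) /\ (alg_closed G H <-> verbally_closed G H).
Proof.
move=> r d _ hd G x hfree g f H.
have vr : verbally_closed G H -> retract G H.
  move=> vc; case: (classic (indep r x 1 g f)) => [hi|dep].
    have Hte : H (test_elt g f (d - 1)).
      by apply: test_elt_closed; [apply: gen_mul | apply: gen_inv | apply: gen_in; left | apply: gen_in; right].
    have [phi [hp [Hp fp]]] := solve_test_elt hfree vc Hte.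
    exact: (retract_of_independent hfree hd hi hp Hp fp).
  have [i [j [hij hs]]] : exists i j : Z, (i <> 0 \/ j <> 0)%Z /\ rho r x 1 (zpow g i ** zpow f j) = \e.
    apply: NNPP => no; apply: dep => i j hs; apply: NNPP => hij; apply: no; exists i, j; split=> //.
    lia.
  have hd1 : 1 <= d by lia.
  exact: (retract_of_dependent hfree hd1 vc hij hs).
split; split=> h.
- exact: retract_alg_closed.
- by apply/vr/alg_closed_verbally_closed.
- exact: alg_closed_verbally_closed.
- by apply/retract_alg_closed/vr.
Qed.
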